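(* Let $S\subset\mathbb{R}^n_+$ be compact and convex with $0\in S$ and set $\sigma_S=\varphi_S(\mathbf{1})$. Then the following are equivalent: (i) $S$ is a lower set; (ii) $S=\widehat S_{\mathbb{R}^n_+}$; (iii) $\varphi_S(\xi)=\varphi_S(\xi^+)$ for every $\xi\in\mathbb{R}^n$; (iv) $H_S(z-w)\le\sigma_S\|w\|_\infty+H_S(z)$ for all $z,w\in\mathbb{C}^n$; (v) $\mathcal{L}^S(\mathbb{C}^n)$ is translation invariant, i.e. $u\in\mathcal{L}^S(\mathbb{C}^n)$ implies $u(\cdot-w)\in\mathcal{L}^S(\mathbb{C}^n)$ for every $w\in\mathbb{C}^n$; (vi) if $u\in\mathcal{L}^S(\mathbb{C}^n)$, then $u*\psi_\delta\in\mathcal{L}^S(\mathbb{C}^n)$ for every radially symmetric $\psi\in\mathcal{C}^\infty_0(\mathbb{C}^n)$ with $\psi\ge0$, $\int_{\mathbb{C}^n}\psi\,d\lambda=1$, and $\psi_\delta(\zeta)=\delta^{-2n}\psi(\zeta/\delta)$, $\delta>0$.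
   Context: $\mathbb{R}_+=[0,\infty)$, $\mathbf{1}=(1,\dots,1)$, $\xi^+=(\max\{\xi_1,0\},\dots,\max\{\xi_n,0\})$, $\lambda$ is Lebesgue measure. $\varphi_S(\xi)=\max_{s\in S}\langle s,\xi\rangle$. $H_S(z)=\varphi_S(\log|z_1|,\dots,\log|z_n|)$ for $z\in(\mathbb{C}\setminus\{0\})^n$, extended to the coordinate hyperplanes by $\limsup$ from $(\mathbb{C}\setminus\{0\})^n$. $\mathcal{L}^S(\mathbb{C}^n)$: plurisubharmonic $u$ on $\mathbb{C}^n$ with $u\le c_u+H_S$ for a constant $c_u$. $S$ is a lower set if for every $s\in S$ the box $[0,s_1]\times\cdots\times[0,s_n]$ is contained in $S$. $\widehat S_{\mathbb{R}^n_+}=\{x\in\mathbb{R}^n_+\,;\,\langle x,\xi\rangle\le\varphi_S(\xi)\ \forall\xi\in\mathbb{R}^n_+\}$. *)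

(* Defs.v *)
From HB Require Import structures.
From mathcomp Require Import all_boot all_order all_algebra.
From mathcomp Require Import all_classical all_reals all_analysis.
From mathcomp.real_closed Require Export complex.
Export Order.TTheory GRing.Theory Num.Theory.
Export numFieldNormedType.Exports.

Set Implicit Arguments.
Unset Strict Implicit.
Unset Printing Implicit Defensive.

Local Open Scope classical_set_scope.
Local Open Scope ring_scope.
Local Open Scope complex_scope.

Definition inner (R : realType) (n : nat) (s xi : 'rV[R]_n) : R :=
  \sum_(j < n) s 0 j * xi 0 j.

Definition Rnplus (R : realType) (n : nat) : set 'rV[R]_n :=
  [set x | forall j, 0 <= x 0 j].

(* supporting function  phi_S(xi) = max_{s in S} <s, xi>  (S compact, nonempty,
   so the supremum is the maximum) *)
Definition phiS (R : realType) (n : nat) (S : set 'rV[R]_n) (xi : 'rV[R]_n) : R :=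
  sup [set inner s xi | s in S].

Definition onesv (R : realType) (n : nat) : 'rV[R]_n := const_mx 1.

Definition posp (R : realType) (n : nat) (xi : 'rV[R]_n) : 'rV[R]_n :=
  \row_j Num.max (xi 0 j) 0.

Definition lower_set (R : realType) (n : nat) (S : set 'rV[R]_n) : Prop :=
  forall s, S s -> forall x : 'rV[R]_n, (forall j, 0 <= x 0 j <= s 0 j) -> S x.

Definition hatS (R : realType) (n : nat) (S : set 'rV[R]_n) : set 'rV[R]_n :=
  [set x | Rnplus x /\ forall xi, Rnplus xi -> inner x xi <= phiS S xi].

Definition cabs (R : realType) (z : R[i]) : R := ComplexField.Normc.normc z.

Definition supnorm (R : realType) (n : nat) (w : 'rV[R[i]]_n) : R :=
  \big[Num.max/0]_(j < n) cabs (w 0 j).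

Definition eucnorm (R : realType) (n : nat) (w : 'rV[R[i]]_n) : R :=
  Num.sqrt (\sum_(j < n) cabs (w 0 j) ^+ 2).

Definition Cstar (R : realType) (n : nat) : set 'rV[R[i]]_n :=
  [set z | forall j, z 0 j != 0].

Definition logabs (R : realType) (n : nat) (z : 'rV[R[i]]_n) : 'rV[R]_n :=
  \row_j ln (cabs (z 0 j)).

(* H_S(z) = phi_S(log|z_1|,...,log|z_n|) on (C\{0})^n, extended to the
   coordinate hyperplanes by limsup from (C\{0})^n *)
Definition HS (R : realType) (n : nat) (S : set 'rV[R]_n) (z : 'rV[R[i]]_n)
  : \bar R :=
  if `[< Cstar z >] then (phiS S (logabs z))%:E
  else ereal_inf [set ereal_sup [set (phiS S (logabs w))%:E
                                  | w in [set w | Cstar w /\ supnorm (w - z) < r]]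
                 | r in [set r : R | 0 < r]].

Definition usc (R : realType) (n : nat) (u : 'rV[R[i]]_n -> \bar R) : Prop :=
  forall (z : 'rV[R[i]]_n) (c : R), (u z < c%:E)%E ->
    exists2 r : R, 0 < r & forall w, supnorm (w - z) < r -> (u w < c%:E)%E.

Definition expi (R : realType) (t : R) : R[i] := (cos t) +i* (sin t).

(* plurisubharmonic on C^n: u : C^n -> [-oo, +oo), upper semicontinuous, and
   subharmonic on every complex line, i.e. the sub-mean value inequality
   u(a) <= (1/2pi) int_0^{2pi} u(a + e^{it} b) dt holds for all a, b. *)
Definition psh (R : realType) (n : nat) (u : 'rV[R[i]]_n -> \bar R) : Prop :=
  [/\ forall z, (u z < +oo)%E,
      usc u &
      forall a b : 'rV[R[i]]_n,
        (u a <= ((2 * pi)^-1)%:E *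
                \int[@lebesgue_measure R]_(t in `[0%R, (2 * pi)%R])
                   u (a + expi t *: b)%R)%E].

Definition LS (R : realType) (n : nat) (S : set 'rV[R]_n)
  (u : 'rV[R[i]]_n -> \bar R) : Prop :=
  psh u /\ exists c : R, forall z, (u z <= c%:E + HS S z)%E.

Fixpoint iter_int (R : realType) (m : nat) (f : (nat -> R) -> \bar R) : \bar R :=
  match m with
  | 0 => f (fun _ => 0)
  | m'.+1 => \int[@lebesgue_measure R]_(t in [set: R])
               iter_int m' (fun x => f (fun k => if k == m' then t else x k))
  end.

(* Lebesgue integral over C^n = R^{2n}, z_j = x_j + i x_{n+j}
   (computed as an iterated integral, Fubini) *)
Definition intCn (R : realType) (n : nat) (g : 'rV[R[i]]_n -> \bar R) : \bar R :=
  iter_int (n + n) (fun x => g (\row_j (x j +i* x (n + j)))).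

Definition convol (R : realType) (n : nat) (u : 'rV[R[i]]_n -> \bar R)
  (psi : 'rV[R[i]]_n -> R) (z : 'rV[R[i]]_n) : \bar R :=
  intCn (fun zeta => u (z - zeta)%R * (psi zeta)%:E)%E.

Definition psi_delta (R : realType) (n : nat) (psi : 'rV[R[i]]_n -> R) (delta : R)
  (zeta : 'rV[R[i]]_n) : R :=
  delta ^- (2 * n) * psi ((delta^-1)%:C *: zeta).

Fixpoint iderive (R : realType) (V : normedModType R) (vs : seq V) (f : V -> R)
  : V -> R :=
  match vs with
  | [::] => f
  | v :: vs' => 'D_v (iderive vs' f)
  end.

Definition smooth (R : realType) (V : normedModType R) (f : V -> R) : Prop :=
  forall vs : seq V,
    continuous (iderive vs f) /\ forall (x v : V), derivable (iderive vs f) x v.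

Definition realif (R : realType) (n : nat) (x : 'rV[R]_(n + n)) : 'rV[R[i]]_n :=
  \row_j (x 0 (lshift n j) +i* x 0 (rshift n j)).

Definition mollifier (R : realType) (n : nat) (psi : 'rV[R[i]]_n -> R) : Prop :=
  [/\ smooth (psi \o @realif R n),
      exists M : R, forall zeta, M < supnorm zeta -> psi zeta = 0,
      forall zeta zeta', eucnorm zeta = eucnorm zeta' -> psi zeta = psi zeta',
      forall zeta, 0 <= psi zeta &
      intCn (fun zeta => (psi zeta)%:E) = 1%E].

(* Main.v *)
Require Import Defs.
From HB Require Import structures.
From mathcomp Require Import all_boot all_order all_algebra.
From mathcomp Require Import all_classical all_reals all_analysis.
From mathcomp.real_closed Require Import complex.
From mathcomp Require Import measurable_realfun ring lra.
Import Order.TTheory GRing.Theory Num.Theory.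
Import numFieldNormedType.Exports.
Local Open Scope classical_set_scope.
Local Open Scope ring_scope.

Set Implicit Arguments.
Unset Strict Implicit.
Unset Printing Implicit Defensive.

(* The equivalence of (i), (ii), (iii) is convex duality: a point outside the
   compact convex set S is separated from it by a linear form, and on a lower
   set the maximum defining phi_S can be taken at a point whose coordinates
   vanish where xi is negative.  Under (iii), H_S = phi_S(log^+|z_1|, ...,
   log^+|z_n|) on all of C^n, and log^+|z-w| <= log^+|z| + |w| gives (iv), hence
   (v).  The convolution with a mollifier is upper semicontinuous by Fatou's
   lemma and satisfies the sub-mean value inequality by Fubini, and (iv) bounds
   its growth, which gives (vi).

   Back to (iii), take s in S and the function log^+(|z_1|^s_1 ... |z_n|^s_n),
   which is in L^S: the sub-mean value inequality reduces to Jensen's formula.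
   Testing (v) with the translation by (-1, ..., -1) at z_j = exp(t xi_j), or (vi)
   with any mollifier at z_j = i exp(t xi_j), and letting t tend to infinity
   gives <s, xi^+> <= phi_S(xi). *)

(** * Integrals of functions bounded above *)

(** Members of L^S may take the value -oo and need not be bounded below, and [intCn] is an iterated
    integral, so each inner integral must be shown measurable in the remaining variable. This is why
    the work is done in a class that survives integrating out a coordinate: upper semicontinuous
    along sequences, bounded above, supported in a fixed cube. Semicontinuity yields measurability,
    Fatou's lemma carries semicontinuity through each integral, and the upper bound keeps positive
    parts integrable, so that only negative parts can be infinite.

    Statement (vi) says something only if mollifiers exist, hence the explicit bump function. The
    purely imaginary test points are chosen because |z_j - zeta_j| is then at least |Re zeta_j|: the
    logarithm can be small only on slabs |Re zeta_j| <= e, and the kernel's mass there is O(e),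
    while log^+ is nonnegative everywhere. The slab width has to be fixed before t tends to
    infinity, as the error off the slabs grows like log(1/e). *)

Section integral_extra.
Local Open Scope ereal_scope.
Context d (T : measurableType d) (R : realType) (mu : {measure set T -> \bar R}).

(* Unlike [le_integral], no measurability is required: the integral is a
   difference of suprema over simple functions. *)
Lemma integral_mono (D : set T) (f g : T -> \bar R) :
  (forall x, D x -> f x <= g x) ->
  \int[mu]_(x in D) f x <= \int[mu]_(x in D) g x.
Proof.
move=> fg.
have fgD x : (f \_ D) x <= (g \_ D) x.
  by rewrite /patch; case: ifPn => // /set_mem/fg.
rewrite /integral leeB// ereal_sup_le// => _ /= [h hh <-]; exists h => //= x;
  apply: (le_trans (hh x)).
- rewrite !funeposE ge_max !le_max fgD lexx orbT.
  by [].
- rewrite !funenegE ge_max !le_max leeN2 fgD lexx orbT.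
  by [].
Qed.

(* B may take the value +oo or have an infinite integral. *)
Lemma integral_ge0B (A B : T -> \bar R) :
  measurable_fun setT A -> measurable_fun setT B ->
  (forall x, 0 <= A x) -> (forall x, 0 <= B x) ->
  (forall x, A x < +oo) -> \int[mu]_x A x < +oo ->
  \int[mu]_x (A x - B x) = \int[mu]_x A x - \int[mu]_x B x.
Proof.
move=> mA mB A0 B0 Afin iA.
pose f x := A x - B x.
have mf : measurable_fun setT f by apply: emeasurable_funB.
(* All four terms are nonnegative, so this identity integrates termwise; subtraction then takes
   place between the integrals, where that of [A] is finite. *)
have E x : A x + f^\- x = f^\+ x + B x.
  rewrite funeposE funenegE /f; have := A0 x; have := Afin x; have := B0 x.
  case: (A x) => [a| |]//; case: (B x) => [b| |]// b0 _ a0; last first.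
    by rewrite /= maxye maxNye.
  rewrite -EFinB -EFinN -!EFin_max -!EFinD; congr EFin.
  by rewrite opprB /Num.max; case: ifPn; case: ifPn; rewrite ?subr_lt0 -?leNgt ?subr_ge0; lra.
have H : \int[mu]_x A x + \int[mu]_x f^\- x = \int[mu]_x f^\+ x + \int[mu]_x B x.
  rewrite -!ge0_integralD//; first by apply: eq_integral => x _.
  - exact: measurable_funepos.
  - exact: measurable_funeneg.
have pA : \int[mu]_x f^\+ x <= \int[mu]_x A x.
  apply: integral_mono => x _; rewrite funeposE ge_max A0 andbT /f.
  by rewrite -[leRHS]adde0 leeD// leeNl oppe0.
change (\int[mu]_x f x = \int[mu]_x A x - \int[mu]_x B x).
move: H pA iA; rewrite (integralE mu setT f).
have : 0 <= \int[mu]_x f^\+ x by apply: integral_ge0.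
have : 0 <= \int[mu]_x A x by apply: integral_ge0.
have : 0 <= \int[mu]_x B x by apply: integral_ge0.
have : 0 <= \int[mu]_x f^\- x by apply: integral_ge0.
case: (\int[mu]_x A x) => [a| |]//; case: (\int[mu]_x B x) => [b| |]//;
 case: (\int[mu]_x f^\- x) => [m| |]//; case: (\int[mu]_x f^\+ x) => [p| |]//.
by move=> _ _ _ _ [] h _ _; rewrite -!EFinB; congr EFin; lra.
Qed.

(** The sum is rearranged as (f^+ + g^+) - (f^- + g^-), to which [integral_ge0B] applies even when
    the subtracted part has infinite integral. *)
Lemma integralD_posfin (f g : T -> \bar R) :
  measurable_fun setT f -> measurable_fun setT g ->
  (forall x, f x < +oo) -> (forall x, g x < +oo) ->
  \int[mu]_x f^\+ x < +oo -> \int[mu]_x g^\+ x < +oo ->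
  \int[mu]_x (f x + g x) = \int[mu]_x f x + \int[mu]_x g x.
Proof.
move=> mf mg fy gy pf pg.
have mfp := measurable_funepos mf; have mgp := measurable_funepos mg.
have mfn := measurable_funeneg mf; have mgn := measurable_funeneg mg.
have key (u v : \bar R) : u < +oo -> v < +oo ->
    u + v = (maxe u 0 + maxe v 0) - (maxe (- u) 0 + maxe (- v) 0).
  case: u => [a| |]//; case: v => [b| |]// _ _.
  - rewrite -!EFin_max -!EFinD; congr EFin.
    by rewrite /Num.max; do 4 case: ifPn; lra.
  - by rewrite /= !maxNye !maxye -!EFin_max.
  - by rewrite /= !maxNye !maxye -!EFin_max.
  - by rewrite !maxNye /= ?maxye.
transitivity (\int[mu]_x ((f^\+ x + g^\+ x) - (f^\- x + g^\- x))).
  by apply: eq_integral => x _; rewrite !funeposE !funenegE; exact: key.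
have fpy x : f^\+ x < +oo by rewrite funeposE gt_max fy ltry.
have gpy x : g^\+ x < +oo by rewrite funeposE gt_max gy ltry.
rewrite integral_ge0B//.
- rewrite !ge0_integralD// [in RHS](integralE _ _ f) [in RHS](integralE _ _ g).
  rewrite oppeD; last by rewrite ge0_adde_def// inE; apply: integral_ge0.
  by rewrite addeACA.
- exact: emeasurable_funD.
- exact: emeasurable_funD.
- by move=> x; rewrite adde_ge0.
- by move=> x; rewrite adde_ge0.
- by move=> x; rewrite lte_add_pinfty.
- by rewrite ge0_integralD// lte_add_pinfty.
Qed.

Lemma integralZ_posfin (f : T -> \bar R) (c : R) : (0 <= c)%R ->
  measurable_fun setT f -> \int[mu]_x f^\+ x < +oo ->
  \int[mu]_x (c%:E * f x) = c%:E * \int[mu]_x f x.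
Proof.
move=> c0 mf pf.
rewrite integralE [in RHS]integralE ge0_funeposM// ge0_funenegM//.
rewrite !ge0_integralZl_EFin//; last 2 first.
- exact: measurable_funeneg.
- exact: measurable_funepos.
have pfin : \int[mu]_x f^\+ x \is a fin_num by rewrite ge0_fin_numE//; exact: integral_ge0.
by rewrite [in RHS]muleDr// ?muleN// fin_num_adde_defr.
Qed.

End integral_extra.

Section liminf_ereal.
Local Open Scope ereal_scope.
Context (R : realType).
Implicit Types (u : nat -> \bar R) (a b : \bar R).

Lemma lt_limn_einf u a : a < limn_einf u -> \forall k \near \oo, a < u k.
Proof.
rewrite limn_einf_lim; have /cvg_lim -> // := (@cvg_einfs_sup _ u).
move=> /ereal_sup_gt[_ [N _ <-]] aN; exists N => // k Nk.
by apply: (lt_le_trans aN); apply: ereal_inf_lbound; exists k.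
Qed.

Lemma lee_lt_real a b : (forall r : R, r%:E < a -> r%:E <= b) -> a <= b.
Proof.
move=> H; rewrite leNgt; apply/negP; move: a b H => [r| |] [s| |]//= H.
- rewrite lte_fin => sr; have := H ((r + s) / 2)%R.
  by rewrite lte_fin lee_fin => /(_ ltac:(lra)); lra.
- by move=> _; have := H (r - 1)%R; rewrite lte_fin => /(_ ltac:(lra)).
- by move=> _; have := H (s + 1)%R (ltry _); rewrite lee_fin; lra.
- by move=> _; have := H 0%R (ltry _).
Qed.

Lemma limn_einf_ge u a :
  (forall b : R, b%:E < a -> \forall k \near \oo, b%:E < u k) -> a <= limn_einf u.
Proof.
move=> H; rewrite limn_einf_lim; have /cvg_lim -> // := (@cvg_einfs_sup _ u).
apply: lee_lt_real => b /H[N _ HN].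
apply: le_ereal_sup_tmp; exists (einfs u N); first by exists N.
by apply: le_ereal_inf_tmp => _ [k Nk <-]; exact/ltW/HN.
Qed.

End liminf_ereal.

(** * Fatou, Fubini and measurability for semicontinuous functions of one or two variables *)

Section compactly_supported.
Local Open Scope ereal_scope.
Context (R : realType).
Let mu := @lebesgue_measure R.
Implicit Types (K M : R) (g : R -> \bar R).

(* Values may be -oo, and the integral of the negative part may be infinite. *)
Definition ub_supp K M g := [/\ measurable_fun setT g, forall t, g t <= M%:E
  & forall t, (K < `|t|)%R -> g t = 0].

Lemma ub_supp_lty K M g t : ub_supp K M g -> g t < +oo.
Proof. by move=> [_ gM _]; apply: (le_lt_trans (gM t)); exact: ltry. Qed.

(** A finite integrable majorant common to all functions in [ub_supp K M]; subtracting from it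
    produces the nonnegative functions that Fatou's lemma asks for. *)
Definition boxf K M (t : R) : \bar R := (M * \1_(`[(- K)%R, K]) t)%:E.

Lemma boxf_ge0 K M t : (0 <= M)%R -> 0 <= boxf K M t.
Proof. by move=> M0; rewrite lee_fin mulr_ge0. Qed.

Lemma measurable_boxf K M : measurable_fun setT (boxf K M).
Proof.
by apply/measurable_EFinP; apply: measurable_funM => //; exact: measurable_indic.
Qed.

Lemma integral_boxf K M : (0 <= K)%R -> (0 <= M)%R ->
  \int[mu]_t boxf K M t = (M * (2 * K))%:E.
Proof.
move=> K0 M0; under eq_integral do rewrite /boxf EFinM.
rewrite ge0_integralZl_EFin//; last exact/measurable_EFinP/measurable_indic.
rewrite integral_indic//= setIT lebesgue_measure_itv/= lte_fin.
case: ifPn => h; first by rewrite -EFinD -EFinM; congr EFin; lra.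
have -> : K = 0%R by lra.
by rewrite !mulr0 mule0.
Qed.

Lemma boxf_bound K M g : (forall t, g t <= M%:E) ->
   (forall t, (K < `|t|)%R -> g t = 0) -> forall t, g t <= boxf K M t.
Proof.
move=> gM g0 t; rewrite /boxf indicE; case: (boolP (_ \in _)) => [_|].
  by rewrite mulr1.
rewrite notin_setE/= in_itv/= -ler_norml => /negP; rewrite -ltNge => /g0 ->.
by rewrite mulr0.
Qed.

Lemma ub_supp_pos_le K M g t : (0 <= M)%R -> ub_supp K M g -> g^\+ t <= boxf K M t.
Proof.
move=> M0 [_ gM g0]; rewrite funeposE ge_max boxf_ge0// andbT.
exact: boxf_bound.
Qed.

Lemma integral_ub_supp_pos K M g : (0 <= K)%R -> (0 <= M)%R -> ub_supp K M g ->
  \int[mu]_t g^\+ t <= (M * (2 * K))%:E.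
Proof.
move=> K0 M0 gb; rewrite -integral_boxf//; apply: integral_mono => t _.
exact: ub_supp_pos_le.
Qed.

Lemma integral_ub_supp_posy K M g : (0 <= K)%R -> (0 <= M)%R -> ub_supp K M g ->
  \int[mu]_t g^\+ t < +oo.
Proof. by move=> K0 M0 /(integral_ub_supp_pos K0 M0)/le_lt_trans; apply; exact: ltry. Qed.

Lemma integral_ub_supp_le K M g : (0 <= K)%R -> (0 <= M)%R -> ub_supp K M g ->
  \int[mu]_t g t <= (M * (2 * K))%:E.
Proof.
move=> K0 M0 gb; apply: le_trans (integral_ub_supp_pos K0 M0 gb).
by apply: integral_mono => t _; rewrite funeposE le_max lexx.
Qed.

(** Reverse Fatou lemma: limsup g_k <= g pointwise passes to the integrals, by Fatou's lemma for
    [boxf K M - g_ k]. *)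
Lemma ub_supp_fatou K M (g_ : nat -> R -> \bar R) g (c : R) : (0 <= K)%R -> (0 <= M)%R ->
  (forall k, ub_supp K M (g_ k)) -> ub_supp K M g ->
  (forall t (c : R), g t < c%:E -> \forall k \near \oo, g_ k t < c%:E) ->
  \int[mu]_t g t < c%:E -> \forall k \near \oo, \int[mu]_t g_ k t < c%:E.
Proof.
move=> K0 M0 gb_ gb H gc.
pose b := boxf K M.
pose I := (M * (2 * K))%R.
(* Since [b] is finite everywhere, f = b - (b - f) holds also where f is -oo. *)
have decomp f : ub_supp K M f -> [/\ measurable_fun setT (fun t => b t - f t),
    forall t, 0 <= b t - f t & \int[mu]_t f t = I%:E - \int[mu]_t (b t - f t)].
  move=> fb; have [mf fM f0] := fb.
  have mh : measurable_fun setT (fun t => b t - f t).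
    by apply: emeasurable_funB => //; exact: measurable_boxf.
  have h0 t : 0 <= b t - f t.
    by rewrite sube_ge0; [exact: boxf_bound|rewrite /b /boxf ?orbT].
  split => //; rewrite -integral_boxf// -integral_ge0B//.
  - apply: eq_integral => t _; have := ub_supp_lty t fb.
    rewrite /b /boxf; case: (f t) => [r| |]// _.
    by rewrite -!EFinB; congr EFin; lra.
  - exact: measurable_boxf.
  - by move=> t; exact: boxf_ge0.
  - by move=> t; exact: ltry.
  - by rewrite integral_boxf// ltry.
pose h_ k t := b t - g_ k t; pose h t := b t - g t.
have [mh h0 gE] := decomp _ gb.
have hl t : h t <= limn_einf (h_ ^~ t).
  apply: limn_einf_ge => r; rewrite /h /h_ /b /boxf; set x := (M * _)%R => rh.
  have : g t < (x - r)%:E by rewrite EFinB lteBrDr// -lte_suber_addl.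
  by move=> /H; apply: filterS => k; rewrite EFinB lteBrDr// -lte_suber_addl.
have ih : (I - c)%:E < \int[mu]_t h t.
  move: gc; rewrite gE lte_subel_addr// => gc'.
  by rewrite EFinB lteBlDl.
have : (I - c)%:E < limn_einf (fun k => \int[mu]_t h_ k t).
  apply: (lt_le_trans ih); apply: le_trans (fatou _ _ _ _) => //.
  - exact: integral_mono.
  - by move=> k; have [] := decomp _ (gb_ k).
  - by move=> k t _; have [_ + _] := decomp _ (gb_ k); exact.
move/lt_limn_einf; apply: filterS => k.
have [_ _ ->] := decomp _ (gb_ k); rewrite lte_subel_addr// EFinB lteBlDl//.
Qed.

(** Tonelli is applied to the positive and negative parts separately. The integrals of the positive
    part are finite by the box bound, which allows the subtraction in both orders; those of the
    negative part may be infinite. *)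
Lemma fubini_ub_supp K M (F : R -> R -> \bar R) : (0 <= K)%R -> (0 <= M)%R ->
  measurable_fun [set: measurableTypeR R * measurableTypeR R] (fun p => F p.1 p.2) ->
  (forall t s, F t s <= M%:E) ->
  (forall t s, (K < `|t|)%R -> F t s = 0) ->
  (forall t s, (K < `|s|)%R -> F t s = 0) ->
  \int[mu]_t \int[mu]_s F t s = \int[mu]_s \int[mu]_t F t s.
Proof.
move=> K0 M0 mF FM F1 F2.
pose G p := F p.1 p.2.
have mp : measurable_fun [set: measurableTypeR R * measurableTypeR R] G^\+.
  exact: measurable_funepos.
have mn : measurable_fun [set: measurableTypeR R * measurableTypeR R] G^\-.
  exact: measurable_funeneg.
have swap (H : measurableTypeR R * measurableTypeR R -> \bar R) :
    measurable_fun setT H -> (forall x, 0 <= H x) ->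
    \int[mu]_t \int[mu]_s H (t, s) = \int[mu]_s \int[mu]_t H (t, s).
  by move=> mH H0; apply: fubini_tonelli.
have I0 : (0 <= M * (2 * K))%R by rewrite !mulr_ge0.
have b1 t : \int[mu]_s G^\+ (t, s) <= boxf K (M * (2 * K)) t.
  apply: (@boxf_bound _ _ (fun t => \int[mu]_s G^\+ (t, s))) => {}t.
  - rewrite -integral_boxf//; apply: integral_mono => s _.
    rewrite funeposE ge_max boxf_ge0// andbT.
    exact: (boxf_bound (FM t) (F2 t)).
  - move=> Kt; apply: integral0_eq => s _.
    by rewrite funeposE /G /= F1// maxxx.
have b2 s : \int[mu]_t G^\+ (t, s) <= boxf K (M * (2 * K)) s.
  apply: (@boxf_bound _ _ (fun s => \int[mu]_t G^\+ (t, s))) => {}s.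
  - rewrite -integral_boxf//; apply: integral_mono => t _.
    rewrite funeposE ge_max boxf_ge0// andbT.
    exact: (boxf_bound (FM ^~ s) (F1 ^~ s)).
  - move=> Kt; apply: integral0_eq => t _.
    by rewrite funeposE /G /= F2// maxxx.
have bi (f : R -> \bar R) : (forall t, f t <= boxf K (M * (2 * K)) t) ->
    \int[mu]_t f t < +oo.
  move=> fb; apply: (@le_lt_trans _ _ (\int[mu]_t boxf K (M * (2 * K)) t)).
    exact: integral_mono.
  by rewrite integral_boxf// ltry.
transitivity (\int[mu]_t (\int[mu]_s G^\+ (t, s) - \int[mu]_s G^\- (t, s))).
  by apply: eq_integral => t _; rewrite [LHS]integralE;
    congr (_ - _); apply: eq_integral => s _; rewrite ?funeposE ?funenegE.
rewrite integral_ge0B; last 6 first.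
- exact: (measurable_fun_fubini_tonelli_F _ mp).
- exact: (measurable_fun_fubini_tonelli_F _ mn).
- by move=> t; apply: integral_ge0.
- by move=> t; apply: integral_ge0.
- by move=> t; apply: (le_lt_trans (b1 t)); exact: ltry.
- exact: bi.
rewrite swap// swap// -integral_ge0B.
- by apply: eq_integral => s _; rewrite [RHS]integralE;
    congr (_ - _); apply: eq_integral => t _; rewrite ?funeposE ?funenegE.
- exact: (measurable_fun_fubini_tonelli_G _ mp).
- exact: (measurable_fun_fubini_tonelli_G _ mn).
- by move=> t; apply: integral_ge0.
- by move=> t; apply: integral_ge0.
- by move=> t; apply: (le_lt_trans (b2 t)); exact: ltry.
- exact: bi.
Qed.

Lemma measurable_lt_open d (T : measurableType d) (f : T -> \bar R) :
  (forall c : R, measurable [set x | f x < c%:E]) -> measurable_fun setT f.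
Proof.
move=> H; apply: (measurability _ (ErealGenCInfty.measurableE R)).
move=> /= _ [_ [a ->]] <-; apply: measurableI => //.
rewrite preimage_itvcy (_ : [set x | _] = ~` [set x | f x < a%:E]).
  exact/measurableC/H.
by apply/seteqP; split => x /=; rewrite leNgt => /negP.
Qed.

(** Sequential, because the semicontinuity of integrals will come from Fatou's lemma. *)
Definition usc_seq2 (F : R -> R -> \bar R) := forall (t_ s_ : nat -> R) t s,
  t_ k @[k --> \oo] --> t -> s_ k @[k --> \oo] --> s ->
  forall c : R, F t s < c%:E -> \forall k \near \oo, F (t_ k) (s_ k) < c%:E.

Lemma usc_seq2_box F t s (c : R) : usc_seq2 F -> F t s < c%:E ->
  exists2 r : R, (0 < r)%R & forall t' s', (`|t' - t| < r)%R -> (`|s' - s| < r)%R ->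
    F t' s' < c%:E.
Proof.
move=> uF Fc; apply: contrapT => H.
have {}H k : exists p : R * R, [/\ (`|p.1 - t| < k.+1%:R^-1)%R,
    (`|p.2 - s| < k.+1%:R^-1)%R & ~ F p.1 p.2 < c%:E].
  apply: contrapT => H'; apply: H; exists k.+1%:R^-1%R; first by rewrite invr_gt0.
  by move=> t' s' h1 h2; apply: contrapT => h3; apply: H'; exists (t', s').
have [p_ Hp] := choice H.
have cv (u : nat -> R) v : (forall k, `|u k - v| < k.+1%:R^-1)%R -> u k @[k --> \oo] --> v.
  move=> uv; apply/cvgrPdist_lt => e e0; near=> k.
  rewrite distrC; apply: (lt_trans (uv k)).
  by near: k; exact: near_infty_natSinv_lt (PosNum e0).
have := uF (fun k => (p_ k).1) (fun k => (p_ k).2) t s _ _ c Fc.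
have c1 : (p_ k).1 @[k --> \oo] --> t by apply: cv => k; have [] := Hp k.
have c2 : (p_ k).2 @[k --> \oo] --> s by apply: cv => k; have [] := Hp k.
by move=> /(_ c1 c2)[N _ /(_ N (leqnn N))]; have [_ _] := Hp N.
Unshelve. all: by end_near. Qed.

(** Sublevel sets are open, hence countable unions of rational squares, and squares belong to the
    product sigma-algebra. *)
Lemma usc_seq2_measurable F : usc_seq2 F ->
  measurable_fun [set: measurableTypeR R * measurableTypeR R] (fun p => F p.1 p.2).
Proof.
move=> uF; apply: measurable_lt_open => c.
pose B (x : R) (r : R) : set R := `](x - r)%R, (x + r)%R[%classic.
pose C (q1 q2 r : rat) : set (measurableTypeR R * measurableTypeR R) :=
  if `[< forall p, (B (ratr q1) (ratr r) `*` B (ratr q2) (ratr r)) p -> F p.1 p.2 < c%:E >]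
  then B (ratr q1) (ratr r) `*` B (ratr q2) (ratr r) else set0.
rewrite (_ : [set x | _] = \bigcup_q1 \bigcup_q2 \bigcup_r C q1 q2 r).
  do 3 (apply: bigcupT_measurable_rat => ?).
  rewrite /C; case: asboolP => // _; apply: measurableX; exact: measurable_itv.
apply/seteqP; split => [[t s]/= Fts|[t s]/= [q1 _ [q2 _ [r _]]]]; last first.
  by rewrite /C; case: asboolP => // H ?; apply: (H (t, s)).
have [r r0 Hr] := usc_seq2_box uF Fts.
(* With centres within q of (t, s), the square of radius q contains (t, s) and stays within 2q < r
   of it. *)
have [q] := @rat_in_itvoo R 0 (r / 2)%R ltac:(lra).
rewrite in_itv/= => /andP[q0 qr].
have [q1] := @rat_in_itvoo R (t - ratr q)%R (t + ratr q)%R ltac:(lra).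
have [q2] := @rat_in_itvoo R (s - ratr q)%R (s + ratr q)%R ltac:(lra).
rewrite !in_itv/= => /andP[q2l q2r] /andP[q1l q1r].
exists q1 => //; exists q2 => //; exists q => //.
rewrite /C; case: asboolP => [_|].
  by split; rewrite /B /= in_itv/=; apply/andP; split; lra.
case=> -[t' s']; rewrite /B /= !in_itv/= => -[/andP[? ?] /andP[? ?]].
by apply: Hr; rewrite ltr_norml; apply/andP; split; lra.
Qed.

Definition usc_seq1 (f : R -> \bar R) := forall (t_ : nat -> R) t,
  t_ k @[k --> \oo] --> t ->
  forall c : R, f t < c%:E -> \forall k \near \oo, f (t_ k) < c%:E.

Lemma usc_seq1_measurable f : usc_seq1 f -> measurable_fun setT f.
Proof.
move=> uf.
have : usc_seq2 (fun t _ => f t) by move=> t_ s_ t s ct _; exact: uf.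
move/usc_seq2_measurable => mf.
exact: (measurableT_comp mf (pair2_measurable (0%R : measurableTypeR R))).
Qed.

End compactly_supported.

(** * Iterated integrals of upper semicontinuous functions *)

Section scaling.
Local Open Scope ereal_scope.
Context (R : realType).
Let mu := @lebesgue_measure R.

(** Lebesgue measure is determined by its values on intervals, and there it agrees with 1/d times
    its pushforward under t -> t/d. *)
Lemma integral_scale (g : R -> \bar R) (d : R) : (0 < d)%R ->
  measurable_fun setT g -> (forall t, 0 <= g t) ->
  \int[mu]_t g (t / d)%R = d%:E * \int[mu]_t g t.
Proof.
move=> d0 mg g0.
pose phi0 (t : measurableTypeR R) : measurableTypeR R := (t / d)%R.
have mphi : measurable_fun [set: measurableTypeR R] phi0 by exact: measurable_funM.
pose phi : {mfun measurableTypeR R >-> measurableTypeR R} :=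
  HB.pack phi0 (isMeasurableFun.Build _ _ _ _ _ mphi).
have di0 : (0 <= d^-1)%R by rewrite invr_ge0 ltW.
pose m2' : {measure set (measurableTypeR R) -> \bar R} :=
  mscale (NngNum di0) (pushforward mu phi).
pose m2 := m2' mphi.
have E A : measurable A -> mu A = m2 A.
  move=> mA; apply: lebesgue_measure_unique => //= _ [[a b]] _ <-.
  rewrite /m2 /m2' /mscale /= /pushforward.
  rewrite (_ : phi0 @^-1` _ = `](a * d)%R, (b * d)%R]%classic); last first.
    by apply/seteqP; split => x; rewrite /phi0 /= !in_itv/= ltr_pdivlMr// ler_pdivrMr.
  rewrite !lebesgue_measure_itv/= !lte_fin ltr_pM2r//; case: ifP => _; last by rewrite mule0.
  by rewrite -!EFinB -EFinM -mulrBl mulrCA mulVf ?mulr1// gt_eqF.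
transitivity (\int[pushforward mu phi]_t g t).
  by rewrite ge0_integral_pushforward// => y _; exact: g0.
transitivity (d%:E * \int[m2]_t g t).
  rewrite /m2 /m2' ge0_integral_mscale// muleA -EFinM divff ?mul1e// gt_eqF//.
by congr (_ * _); apply: eq_measure_integral => A mA _; apply/esym; exact: E.
Qed.

End scaling.

Section iterated_integrals.
Local Open Scope ereal_scope.
Context (R : realType).
Let mu := @lebesgue_measure R.
Implicit Types (f g : (nat -> R) -> \bar R) (x : nat -> R) (K M : R).

(** The body repeats the update inside [iter_int], so that slices of an iterated integral are
    convertible to expressions in [upd]. *)
Definition upd x (m : nat) (t : R) : nat -> R := fun k => if k == m then t else x k.

Definition cvg_coord (x_ : nat -> nat -> R) x := forall j, x_ k j @[k --> \oo] --> x j.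

(* Encodes limsup f_k(x_k) <= f(x) for every coordinatewise limit x of x_k,
   with f_k allowed to vary so that parameters can be moved to the limit. *)
Definition usc_along (f_ : nat -> (nat -> R) -> \bar R) f :=
  forall (x_ : nat -> nat -> R) x, cvg_coord x_ x ->
  forall c : R, f x < c%:E -> \forall k \near \oo, f_ k (x_ k) < c%:E.

(** The support is constrained in the [m] integrated coordinates, so fixing coordinate [m] takes the
    class for [m.+1] to the class for [m]. *)
Definition usc_supp m K M f := [/\ usc_along (fun=> f) f, forall x, f x <= M%:E &
  forall x j, (j < m)%N -> (K < `|x j|)%R -> f x = 0].

Lemma iter_int_mono m f g : (forall x, f x <= g x) -> iter_int m f <= iter_int m g.
Proof.
elim: m f g => [|m IH] f g fg /=; first exact: fg.
by apply: integral_mono => t _; exact: IH.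
Qed.

Lemma iter_int0 m : iter_int m (fun=> 0) = 0 :> \bar R.
Proof. by elim: m => //= m IH; rewrite IH integral0. Qed.

Lemma cvg_upd (x_ : nat -> nat -> R) x m t_ t : cvg_coord x_ x -> t_ k @[k --> \oo] --> t ->
  cvg_coord (fun k => upd (x_ k) m (t_ k)) (upd x m t).
Proof. by move=> cx ct j; rewrite /upd; case: ifP. Qed.

Lemma usc_supp_slice m K M f t : usc_supp m.+1 K M f -> usc_supp m K M (fun x => f (upd x m t)).
Proof.
move=> [uf fM f0]; split => //.
- by move=> x_ x cx c; apply: uf; apply: cvg_upd => //; exact: cvg_cst.
- move=> x j jm Kx; apply: (f0 _ j); first exact: ltnW.
  by rewrite /upd ltn_eqF.
Qed.

(** The bound and the semicontinuity form a single induction: reverse Fatou for the outer integral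
    needs the inner one bounded and measurable in the outer variable, and measurability comes from
    the inductive semicontinuity applied to slices with a moving parameter. The factor (2K)^m is the
    volume of the cube. *)
Lemma iter_int_usc_supp m K M : (0 <= K)%R -> (0 <= M)%R ->
  (forall f, usc_supp m K M f -> iter_int m f <= (M * (2 * K) ^+ m)%:E) /\
  (forall (f_ : nat -> (nat -> R) -> \bar R) f, (forall k, usc_supp m K M (f_ k)) -> usc_supp m K M f -> usc_along f_ f ->
    forall c : R, iter_int m f < c%:E -> \forall k \near \oo, iter_int m (f_ k) < c%:E).
Proof.
move=> K0 M0; elim: m => [|m [IHa IHb]].
  split=> [f [_ fM _]|f_ f _ _ uf c] /=; first by rewrite expr0 mulr1.
  by apply: (uf (fun=> fun=> 0%R)) => j; exact: cvg_cst.
pose G f t := iter_int m (fun x => f (upd x m t)).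
have Mm0 : (0 <= M * (2 * K) ^+ m)%R by rewrite mulr_ge0// exprn_ge0// mulr_ge0.
have bG f : usc_supp m.+1 K M f -> ub_supp K (M * (2 * K) ^+ m) (G f).
  move=> af; split.
  - apply: usc_seq1_measurable => t_ t ct c; apply: IHb.
    + by move=> k; exact: usc_supp_slice.
    + exact: usc_supp_slice.
    + by move=> x_ x cx; have [uf _ _] := af; apply: uf; exact: cvg_upd.
  - by move=> t; apply: IHa; exact: usc_supp_slice.
  - move=> t Kt; rewrite /G (_ : (fun x => _) = fun=> 0) ?iter_int0//.
    by apply/funext => x; have [_ _ f0] := af; apply: (f0 _ m) => //; rewrite /upd eqxx.
split=> [f af|f_ f af_ af uf c] /=.
  rewrite exprS (mulrC (2 * K)%R) mulrA; exact: (integral_ub_supp_le K0 Mm0 (bG f af)).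
apply: (ub_supp_fatou K0 Mm0 (fun k => bG _ (af_ k)) (bG _ af)) => t d.
apply: IHb => [k||]; try exact: usc_supp_slice.
by move=> x_ x cx; apply: uf; apply: cvg_upd => //; exact: cvg_cst.
Qed.

Lemma iter_int_le m K M f : (0 <= K)%R -> (0 <= M)%R -> usc_supp m K M f ->
  iter_int m f <= (M * (2 * K) ^+ m)%:E.
Proof. by move=> K0 M0 af; have [+ _] := iter_int_usc_supp m K0 M0; exact. Qed.

Lemma iter_int_usc_along m K M (f_ : nat -> (nat -> R) -> \bar R) f : (0 <= K)%R -> (0 <= M)%R ->
  (forall k, usc_supp m K M (f_ k)) -> usc_supp m K M f -> usc_along f_ f ->
  forall c : R, iter_int m f < c%:E -> \forall k \near \oo, iter_int m (f_ k) < c%:E.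
Proof. by move=> K0 M0 af; have [_ +] := iter_int_usc_supp m K0 M0; exact. Qed.

Lemma iter_int_ub_supp m K M f : (0 <= K)%R -> (0 <= M)%R -> usc_supp m.+1 K M f ->
  ub_supp K (M * (2 * K) ^+ m) (fun t => iter_int m (fun x => f (upd x m t))).
Proof.
move=> K0 M0 af; split.
- apply: usc_seq1_measurable => t_ t ct c; apply: (iter_int_usc_along K0 M0).
  + by move=> k; exact: usc_supp_slice.
  + exact: usc_supp_slice.
  + by move=> x_ x cx; have [uf _ _] := af; apply: uf; exact: cvg_upd.
- by move=> t; apply: iter_int_le => //; exact: usc_supp_slice.
- move=> t Kt; rewrite (_ : (fun x => _) = fun=> 0) ?iter_int0//.
  by apply/funext => x; have [_ _ f0] := af; apply: (f0 _ m) => //; rewrite /upd eqxx.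
Qed.

Lemma iter_intZ m K M f (c : R) : (0 <= K)%R -> (0 <= M)%R -> (0 <= c)%R ->
  usc_supp m K M f -> iter_int m (fun x => c%:E * f x) = c%:E * iter_int m f.
Proof.
move=> K0 M0 c0; elim: m f => [//|m IH] f af /=.
have Mm0 : (0 <= M * (2 * K) ^+ m)%R by rewrite mulr_ge0// exprn_ge0// mulr_ge0.
have bf := iter_int_ub_supp K0 M0 af.
rewrite -[RHS]integralZ_posfin//.
- by apply: eq_integral => t _; rewrite IH//; exact: usc_supp_slice.
- by case: bf.
- exact: (integral_ub_supp_posy K0 Mm0 bf).
Qed.

Lemma iter_intD m K M M' f g : (0 <= K)%R -> (0 <= M)%R -> (0 <= M')%R ->
  usc_supp m K M f -> usc_supp m K M' g ->
  iter_int m (fun x => f x + g x) = iter_int m f + iter_int m g.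
Proof.
move=> K0 M0 M'0; elim: m f g => [//|m IH] f g af ag /=.
have Mm0 : (0 <= M * (2 * K) ^+ m)%R by rewrite mulr_ge0// exprn_ge0// mulr_ge0.
have Mm'0 : (0 <= M' * (2 * K) ^+ m)%R by rewrite mulr_ge0// exprn_ge0// mulr_ge0.
have bf := iter_int_ub_supp K0 M0 af.
have bg := iter_int_ub_supp K0 M'0 ag.
rewrite -[RHS]integralD_posfin//.
- by apply: eq_integral => t _; rewrite IH//; exact: usc_supp_slice.
- by case: bf.
- by case: bg.
- by move=> t; exact: (ub_supp_lty t bf).
- by move=> t; exact: (ub_supp_lty t bg).
- exact: (integral_ub_supp_posy K0 Mm0 bf).
- exact: (integral_ub_supp_posy K0 Mm'0 bg).
Qed.

Lemma usc_along_add (f_ g_ : nat -> (nat -> R) -> \bar R) f g : (forall x, f x < +oo) -> (forall x, g x < +oo) ->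
  usc_along f_ f -> usc_along g_ g -> usc_along (fun k x => f_ k x + g_ k x) (fun x => f x + g x).
Proof.
move=> fy gy uf ug x_ x cx c fgc.
(* If both values are finite, the gap c - (f x + g x) is shared equally; a value -oo leaves the
   other bound free. *)
have [a [b [fa gb abc]]] : exists a b : R, [/\ f x < a%:E, g x < b%:E & (a + b <= c)%R].
  move: fgc (fy x) (gy x); case: (f x) => [u| |]//; case: (g x) => [v| |]// fgc _ _.
  - exists (u + (c - (u + v)) / 2)%R, (v + (c - (u + v)) / 2)%R.
    by move: fgc; rewrite -EFinD !lte_fin => ?; split; lra.
  - by exists (u + 1)%R, (c - (u + 1))%R; rewrite ltNyr !lte_fin; split => //; lra.
  - by exists (c - (v + 1))%R, (v + 1)%R; rewrite ltNyr !lte_fin; split => //; lra.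
  - by exists c, 0%R; rewrite !ltNyr; split => //; lra.
apply: filterS2 (uf _ _ cx _ fa) (ug _ _ cx _ gb) => k h1 h2.
by apply: (lt_le_trans (lteD h1 h2)); rewrite -EFinD lee_fin.
Qed.

Lemma usc_supp_add m K M M' f g : usc_supp m K M f -> usc_supp m K M' g ->
  usc_supp m K (M + M') (fun x => f x + g x).
Proof.
move=> [uf fM f0] [ug gM g0]; split.
- apply: usc_along_add => // x.
  + by apply: (le_lt_trans (fM x)); exact: ltry.
  + by apply: (le_lt_trans (gM x)); exact: ltry.
- by move=> x; rewrite EFinD; exact: leeD.
- by move=> x j jm Kx; rewrite (f0 _ j)// (g0 _ j)// adde0.
Qed.

Lemma usc_supp0 m K : usc_supp m K 0 (fun=> 0).
Proof. by split=> // x_ x _ c c0; exact: nearW. Qed.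

(** Both conclusions go through one induction, since [iter_intD] asks that the remaining sum be in
    the class. *)
Lemma iter_int_sum m n K (M : 'I_n -> R) (f : 'I_n -> (nat -> R) -> \bar R) :
  (0 <= K)%R -> (forall i, 0 <= M i)%R -> (forall i, usc_supp m K (M i) (f i)) ->
  iter_int m (fun x => \sum_(i < n) f i x) = \sum_(i < n) iter_int m (f i) /\
  usc_supp m K (\sum_(i < n) M i)%R (fun x => \sum_(i < n) f i x).
Proof.
move=> K0; elim: n M f => [|n IH] M f M0 af.
  rewrite !big_ord0; rewrite (_ : (fun x => _) = fun=> 0).
    by rewrite iter_int0; split => //; exact: usc_supp0.
  by apply/funext => x; rewrite big_ord0.
have [I1 I2] := IH (fun i => M (lift ord0 i)) (fun i => f (lift ord0 i))
  (fun i => M0 _) (fun i => af _).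
rewrite (_ : (fun x => _) = (fun x => f ord0 x + \sum_(i < n) f (lift ord0 i) x)); last first.
  by apply/funext => x; rewrite big_ord_recl.
rewrite !big_ord_recl; split; last exact: usc_supp_add.
by rewrite (iter_intD K0 (M0 ord0) _ (af ord0) I2) ?I1//; exact: sumr_ge0.
Qed.

Lemma usc_supp_weak m K K' M M' f : (K <= K')%R -> (M <= M')%R -> usc_supp m K M f -> usc_supp m K' M' f.
Proof.
move=> KK MM [uf fM f0]; split => //.
- by move=> x; apply: (le_trans (fM x)); rewrite lee_fin.
- by move=> x j jm Kx; apply: (f0 _ j) => //; exact: le_lt_trans Kx.
Qed.

(** The parameter integral moves inwards past one coordinate at a time. At each stage the inner
    iterated integral is jointly semicontinuous in the parameter and the coordinate, hence
    measurable for the product. *)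
Lemma iter_int_fubini m K M L (F : R -> (nat -> R) -> \bar R) :
  (0 <= K)%R -> (0 <= M)%R -> (L <= K)%R ->
  (forall t, usc_supp m K M (F t)) ->
  (forall t_ t, t_ k @[k --> \oo] --> t -> usc_along (fun k => F (t_ k)) (F t)) ->
  \int[mu]_(t in `[0%R, L]) iter_int m (F t) =
  iter_int m (fun x => \int[mu]_(t in `[0%R, L]) F t x).
Proof.
move=> K0 M0 LK; elim: m F => [//|m IH] F aF uF /=.
have Mm0 : (0 <= M * (2 * K) ^+ m)%R by rewrite mulr_ge0// exprn_ge0// mulr_ge0.
pose G t s := iter_int m (fun x => F t (upd x m s)).
have uG : usc_seq2 G.
  move=> t_ s_ t s ct cs c; apply: (iter_int_usc_along K0 M0).
  - by move=> k; exact: usc_supp_slice.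
  - exact: usc_supp_slice.
  - by move=> x_ x cx; apply: uF => //; exact: cvg_upd.
have bG t := iter_int_ub_supp K0 M0 (aF t).
pose D : set R := `[0%R, L]%classic.
(* The cut-off, together with L <= K, places the support in the square of half side K also in the
   variable t. *)
pose H t s := if t \in D then G t s else 0.
have mH : measurable_fun [set: measurableTypeR R * measurableTypeR R] (fun p => H p.1 p.2).
  pose D2 : set (measurableTypeR R * measurableTypeR R) := D `*` setT.
  have mD2 : measurable D2 by apply: measurableX => //; exact: measurable_itv.
  have := usc_seq2_measurable uG.
  move=> /(@measurable_funS _ _ _ _ _ D2 _ measurableT (@subsetT _ _)).
  move=> /(measurable_restrictT _ mD2).
  congr measurable_fun; apply/funext => -[t s]; rewrite /patch /H /D2 /=.
  by congr (if _ then _ else _); rewrite in_setX/= in_setT andbT.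
rewrite integral_mkcond.
transitivity (\int[mu]_t \int[mu]_s H t s).
  apply: eq_integral => t _; rewrite /patch /H -/D.
  by case: ifP => // _; rewrite integral0.
rewrite (@fubini_ub_supp _ K (M * (2 * K) ^+ m))//.
- apply: eq_integral => s _.
  rewrite -(IH (fun t x => F t (upd x m s))).
  + by rewrite [RHS]integral_mkcond; apply: eq_integral => t _; rewrite /patch /H.
  + by move=> t; exact: usc_supp_slice.
  + move=> t_ t ct x_ x cx; apply: uF => //; apply: cvg_upd => //; exact: cvg_cst.
- by move=> t s; rewrite /H; case: ifP => _; [case: (bG t) => _ + _; exact|rewrite lee_fin].
- move=> t s Kt; rewrite /H; case: ifPn => // /set_mem; rewrite /D/= in_itv/= => /andP[t0 tL].
  by exfalso; move: Kt; rewrite ger0_norm//; lra.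
- by move=> t s Ks; rewrite /H; case: ifP => // _; case: (bG t) => _ _; exact.
Qed.

(** The intervals are closed: at a limit inside the box the value is already the maximum C, and a
    limit outside forces the sequence to be eventually outside. *)
Lemma usc_along_box n (a b : nat -> R) (C : R) : (0 <= C)%R ->
  usc_along (fun=> fun x => (C * \prod_(k < n) \1_(`[a k, b k]) (x k))%:E)
   (fun x => (C * \prod_(k < n) \1_(`[a k, b k]) (x k))%:E).
Proof.
move=> C0 x_ x cx c.
have p1 (y : nat -> R) : (0 <= (\prod_(k < n) \1_(`[a k, b k]) (y k) : R) <= 1)%R.
  apply/andP; split; first by apply: prodr_ge0.
  by apply: prodr_ile1 => i; rewrite indicE; case: (_ \in _); rewrite ?ler01 ?lexx.
have [xin|] := pselect (forall k : 'I_n, `[a k, b k]%classic (x k)).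
  rewrite big1 ?mulr1 => [|k _]; last by rewrite indicE mem_set.
  rewrite lte_fin => Cc; apply: nearW => k; rewrite lte_fin.
  apply: le_lt_trans Cc; rewrite -[leRHS]mulr1 ler_wpM2l//.
  by have /andP[] := p1 (x_ k).
move=> /existsNP[j xj].
have z (y : nat -> R) : ~ `[a j, b j]%classic (y j) ->
    (\prod_(k < n) \1_(`[a k, b k]) (y k) = 0 :> R)%R.
  by move=> yj; rewrite (bigD1 j)//= indicE memNset// mul0r.
rewrite z// mulr0 => c0.
have : \forall k \near \oo, ~ `[a j, b j]%classic (x_ k j).
  apply: (cx j (~` `[a j, b j]%classic)); apply: open_nbhs_nbhs; split => //.
  by apply: closed_openC; exact: itv_closed.
by apply: filterS => k /z ->; rewrite mulr0.
Qed.

Lemma iter_int_box n (a b : nat -> R) (C : R) : (0 <= C)%R ->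
  (forall k, (k < n)%N -> a k <= b k)%R ->
  iter_int n (fun x => (C * \prod_(k < n) \1_(`[a k, b k]) (x k))%:E) =
  (C * \prod_(k < n) (b k - a k))%:E.
Proof.
elim: n C => [|n IH] C C0 ab /=; first by rewrite !big_ord0.
rewrite big_ord_recr/=.
transitivity (\int[mu]_t ((C * \prod_(k < n) (b k - a k)) * \1_(`[a n, b n]) t)%:E).
  apply: eq_integral => t _.
  rewrite mulrAC -IH//; last 2 first.
  - by rewrite mulr_ge0.
  - by move=> k kn; rewrite ab// ltnW.
  congr iter_int; apply/funext => x; congr EFin.
  rewrite big_ord_recr/= /upd eqxx mulrA mulrAC; congr (_ * _ * _)%R.
  by apply: eq_bigr => i _; rewrite ltn_eqF.
under eq_integral do rewrite EFinM.
have P0 : (0 <= \prod_(k < n) (b k - a k))%R.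
  by apply: prodr_ge0 => k _; rewrite subr_ge0 ab// ltnS ltnW.
rewrite ge0_integralZl_EFin//; last 2 first.
- exact/measurable_EFinP/measurable_indic.
- exact: mulr_ge0.
rewrite integral_indic//= setIT lebesgue_measure_itv/= lte_fin mulrA.
have := ab n (ltnSn n); rewrite le_eqVlt => /predU1P[->|->]; last by [].
by rewrite ltxx subrr mulr0 mule0.
Qed.

End iterated_integrals.

(** * Supporting functions and the function H_S *)

Section support_function.
Context (R : realType) (n : nat).
Implicit Types (s x y xi eta : 'rV[R]_n) (S : set 'rV[R]_n).

Lemma innerC x y : inner x y = inner y x.
Proof. by apply: eq_bigr => j _; rewrite mulrC. Qed.

Lemma innerDr x y z : inner x (y + z) = inner x y + inner x z.
Proof. by rewrite /inner -big_split; apply: eq_bigr => j _; rewrite mxE mulrDr. Qed.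

Lemma innerZr x (c : R) y : inner x (c *: y) = c * inner x y.
Proof. by rewrite /inner mulr_sumr; apply: eq_bigr => j _; rewrite mxE mulrCA. Qed.

Lemma innerNr x y : inner x (- y) = - inner x y.
Proof. by rewrite -scaleN1r innerZr mulN1r. Qed.

Lemma innerDl x y z : inner (x + y) z = inner x z + inner y z.
Proof. by rewrite !(innerC _ z) innerDr. Qed.

Lemma innerZl (c : R) x y : inner (c *: x) y = c * inner x y.
Proof. by rewrite !(innerC _ y) innerZr. Qed.

Lemma innerNl x y : inner (- x) y = - inner x y.
Proof. by rewrite !(innerC _ y) innerNr. Qed.

Lemma inner_ge0 x : 0 <= inner x x.
Proof. by apply: sumr_ge0 => j _; rewrite -expr2 sqr_ge0. Qed.

Lemma inner_subZ x y (t : R) :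
  inner (x - t *: y) (x - t *: y) = inner x x - 2 * t * inner y x + t ^+ 2 * inner y y.
Proof.
rewrite !(innerDl, innerDr, innerNl, innerNr, innerZl, innerZr) (innerC x y).
ring.
Qed.

Lemma inner_eq0 x : inner x x = 0 -> x = 0.
Proof.
move=> /eqP; rewrite psumr_eq0 => [/allP H|j _]; last by rewrite -expr2 sqr_ge0.
apply/rowP => j; rewrite mxE; apply/eqP.
by have := H j (mem_index_enum _); rewrite /= mulf_eq0 orbb.
Qed.

Lemma inner_ler s xi eta : Rnplus s -> (forall j, xi 0 j <= eta 0 j) ->
  inner s xi <= inner s eta.
Proof. by move=> s0 h; apply: ler_sum => j _; rewrite ler_wpM2l. Qed.

Lemma le_posp xi j : xi 0 j <= posp xi 0 j.
Proof. by rewrite mxE le_max lexx. Qed.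

Lemma posp_ge0 xi : Rnplus (posp xi).
Proof. by move=> j; rewrite mxE le_max lexx orbT. Qed.

Lemma continuous_coord (j : 'I_n) : continuous (fun x : 'rV[R]_n => x 0 j).
Proof. exact: coord_continuous. Qed.

Lemma cvg_sumr (T : Type) (F : set_system T) {FF : Filter F} (m : nat)
    (f : 'I_m -> T -> R) (l : 'I_m -> R) :
  (forall i, f i x @[x --> F] --> l i) ->
  (\sum_(i < m) f i x) @[x --> F] --> \sum_(i < m) l i.
Proof.
elim: m f l => [|m IH] f l h.
  by under eq_fun do rewrite big_ord0; rewrite big_ord0; exact: cvg_cst.
under eq_fun do rewrite big_ord_recl; rewrite big_ord_recl.
by apply: cvgD; [exact: h|apply: IH => i; exact: h].
Qed.

Lemma continuous_innerl xi : continuous (fun s => inner s xi).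
Proof.
move=> s; rewrite /inner; apply: (@cvg_sumr _ (nbhs s) _) => j.
by apply: cvgM; [exact: continuous_coord|exact: cvg_cst].
Qed.

Lemma continuous_dist2 x : continuous (fun y => inner (x - y) (x - y)).
Proof.
move=> y; rewrite /inner; apply: (@cvg_sumr _ (nbhs y) _) => j.
have h : (fun y => (x - y) 0 j) @ y --> (x - y) 0 j.
  under eq_fun do rewrite !mxE; rewrite !mxE.
  apply: (@cvgB _ _ _ (nbhs y) _ (fun=> x 0 j) (fun y => y 0 j)); first exact: cvg_cst.
  exact: continuous_coord.
exact: cvgM.
Qed.

Lemma phiSP S xi : compact S -> S !=set0 ->
  exists s, [/\ S s, phiS S xi = inner s xi & forall s', S s' -> inner s' xi <= phiS S xi].
Proof.
move=> cS S0.
have [s /set_mem Ss smax] := EVT_max_rV S0 cS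
  (continuous_subspaceT (@continuous_innerl xi)).
have ub : ubound [set inner s xi | s in S] (inner s xi).
  by move=> _ [t St <-]; apply: smax; rewrite inE.
have E : phiS S xi = inner s xi.
  apply/eqP; rewrite eq_le; apply/andP; split.
    by apply: ge_sup => //; exists (inner s xi), s.
  by apply: ub_le_sup; [exists (inner s xi)|exists s].
by exists s; split => // s' Ss'; rewrite E; apply: ub; exists s'.
Qed.

(** The direction is x - p with p the point of S nearest to x: a point s of S with <s - p, x - p> >
    0 would let p move towards s and come closer to x. *)
Lemma separation S x : compact S -> convex_set S -> S !=set0 -> ~ S x ->
  exists xi, phiS S xi < inner x xi.
Proof.
move=> cS vS S0 nSx.
have [p /set_mem Sp pmin] := EVT_min_rV S0 cS
  (continuous_subspaceT (@continuous_dist2 x)).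
exists (x - p).
have [s [Ss -> _]] := phiSP (x - p) cS S0.
have d0 : 0 < inner (x - p) (x - p).
  rewrite lt_neqAle inner_ge0 andbT eq_sym; apply/eqP => /inner_eq0/eqP.
  by rewrite subr_eq0 => /eqP xp; apply: nSx; rewrite xp.
suff A0 : inner (s - p) (x - p) <= 0.
  have -> : inner x (x - p) = inner s (x - p) - inner (s - p) (x - p) + inner (x - p) (x - p).
    by rewrite !innerDl !innerNl; lra.
  lra.
rewrite leNgt; apply/negP; set A := inner (s - p) (x - p) => A0.
set B := inner (s - p) (s - p); have B0 : 0 <= B := inner_ge0 _.
(* The denominator A + B keeps t in (0, 1], so that the point stays in S, and gives tB <= A: the
   gain 2tA then exceeds the loss t^2 B. *)
pose t := A / (A + B).
have AB : 0 < A + B by lra.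
have t0 : 0 < t by rewrite divr_gt0.
have t1 : t <= 1 by rewrite ler_pdivrMr//; lra.
have Sq : S (p + t *: (s - p)).
  have := vS s p (Itv01 (ltW t0) t1) (mem_set Ss) (mem_set Sp).
  rewrite inE; congr S; rewrite /conv /= /unstable.onem scalerBr scalerBl scale1r.
  by rewrite addrCA.
have := pmin _ (mem_set Sq).
have -> : x - (p + t *: (s - p)) = (x - p) - t *: (s - p) by rewrite opprD addrA.
rewrite inner_subZ -/A -/B.
have tAB : t * (A + B) = A by rewrite divfK// gt_eqF.
move=> h.
have : t * (2 * A - t * B) <= 0 by lra.
rewrite pmulr_rle0//.
have : t * B <= A by nra.
lra.
Qed.

Section fixed_S.
Variable S : set 'rV[R]_n.
Hypotheses (cS : compact S) (SR : S `<=` @Rnplus R n) (S0 : S 0).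

Let Sn0 : S !=set0. Proof. by exists 0. Qed.

Lemma phiS_ub s xi : S s -> inner s xi <= phiS S xi.
Proof. by move=> Ss; have [t [_ _]] := phiSP xi cS Sn0; exact. Qed.

Lemma phiS_ge0 xi : 0 <= phiS S xi.
Proof.
have <- : inner 0 xi = 0 by rewrite /inner big1// => j _; rewrite mxE mul0r.
exact: phiS_ub.
Qed.

Lemma phiS_mono xi eta : (forall j, xi 0 j <= eta 0 j) -> phiS S xi <= phiS S eta.
Proof.
move=> h; have [s [Ss -> _]] := phiSP xi cS Sn0.
by apply: le_trans (phiS_ub eta Ss); apply: inner_ler => //; exact: SR.
Qed.

Lemma phiSD xi eta : phiS S (xi + eta) <= phiS S xi + phiS S eta.
Proof.
have [s [Ss -> _]] := phiSP (xi + eta) cS Sn0.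
by rewrite innerDr lerD// phiS_ub.
Qed.

Lemma phiSZ (c : R) xi : 0 <= c -> phiS S (c *: xi) <= c * phiS S xi.
Proof.
move=> c0; have [s [Ss -> _]] := phiSP (c *: xi) cS Sn0.
by rewrite innerZr ler_wpM2l// phiS_ub.
Qed.

Lemma lower_set_phiS : lower_set S -> forall xi, phiS S xi = phiS S (posp xi).
Proof.
move=> lS xi; apply/eqP; rewrite eq_le phiS_mono/=; last exact: le_posp.
have [s [Ss -> _]] := phiSP (posp xi) cS Sn0.
pose s' : 'rV[R]_n := \row_j (if 0 <= xi 0 j then s 0 j else 0).
have -> : inner s (posp xi) = inner s' xi.
  apply: eq_bigr => j _; rewrite !mxE; case: ifPn => h; first by rewrite max_l.
  by rewrite max_r ?mulr0 ?mul0r// ltW// ltNge.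
apply: phiS_ub; apply: (lS s) => // j; rewrite !mxE; have s0 := SR Ss j.
by case: ifP; rewrite ?s0 ?lexx.
Qed.

Lemma hatS_lower : S = hatS S -> lower_set S.
Proof.
move=> E s Ss x xs; rewrite E; split=> [j|xi xi0]; first by have /andP[] := xs j.
apply: le_trans (phiS_ub xi Ss); apply: ler_sum => j _; rewrite ler_wpM2r//.
by have /andP[] := xs j.
Qed.

(** The hull only constrains nonnegative directions, whereas the separating [xi] is arbitrary.
    Replacing it by [posp xi] leaves phi_S unchanged and cannot decrease <x, xi>, as x has
    nonnegative coordinates. *)
Lemma phiS_hatS : convex_set S -> (forall xi, phiS S xi = phiS S (posp xi)) -> S = hatS S.
Proof.
move=> vS H; apply/seteqP; split=> [s Ss|x [x0 xh]].
  by split; [exact: SR|move=> xi _; exact: phiS_ub].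
apply: contrapT => nSx; have [xi] := separation cS vS Sn0 nSx.
apply/negP; rewrite -leNgt H; apply: le_trans (xh _ (@posp_ge0 xi)).
apply: inner_ler => //; exact: le_posp.
Qed.

End fixed_S.
End support_function.

(** * Moduli, the coordinatewise log^+, and H_S on the coordinate hyperplanes *)

Section complex_space.
Context (R : realType) (n : nat).
Implicit Types (z w : 'rV[R[i]]_n) (S : set 'rV[R]_n).
Local Open Scope complex_scope.

Lemma cabs_ge0 (a : R[i]) : 0 <= cabs a.
Proof. by case: a => x y; rewrite /cabs /= sqrtr_ge0. Qed.

Lemma cabs0 : cabs (0 : R[i]) = 0. Proof. exact: ComplexField.Normc.normc0. Qed.

Lemma cabs_eq0 (a : R[i]) : (cabs a == 0) = (a == 0).
Proof.
by apply/eqP/eqP => [/ComplexField.Normc.eq0_normc//|->]; exact: cabs0.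
Qed.

Lemma cabs_gt0 (a : R[i]) : (0 < cabs a) = (a != 0).
Proof. by rewrite lt_neqAle cabs_ge0 andbT eq_sym cabs_eq0. Qed.

Lemma cabsM (a b : R[i]) : cabs (a * b) = cabs a * cabs b.
Proof. exact: ComplexField.Normc.normcM. Qed.

Lemma cabsD (a b : R[i]) : cabs (a + b) <= cabs a + cabs b.
Proof.
have := ler_normD a b; rewrite !normc_def.
by rewrite -rmorphD/= lecR; case: a => ? ?; case: b => ? ?.
Qed.

Lemma cabsN (a : R[i]) : cabs (- a) = cabs a.
Proof. by case: a => x y; rewrite /cabs /= !sqrrN. Qed.

Lemma cabsB (a b : R[i]) : cabs (a - b) = cabs (b - a).
Proof. by rewrite -cabsN opprB. Qed.

Lemma cabs_real (x : R) : cabs (x%:C) = `|x|.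
Proof. by rewrite /cabs /= expr0n/= addr0 sqrtr_sqr. Qed.

Lemma cabs_ge_Re (x y : R) : `|x| <= cabs (x +i* y).
Proof. by rewrite /cabs /= -sqrtr_sqr ler_wsqrtr// lerDl sqr_ge0. Qed.

Lemma cabs_ge_Im (x y : R) : `|y| <= cabs (x +i* y).
Proof. by rewrite /cabs /= -sqrtr_sqr ler_wsqrtr// lerDr sqr_ge0. Qed.

Lemma cabs_le_ReIm (x y : R) : cabs (x +i* y) <= `|x| + `|y|.
Proof.
rewrite /cabs /= -[leRHS]ger0_norm ?addr_ge0// -sqrtr_sqr ler_wsqrtr// sqrrD.
by rewrite !real_normK ?num_real// -addrA lerD2l lerDr mulrn_wge0// mulr_ge0.
Qed.

Lemma supnorm_ge z j : cabs (z 0 j) <= supnorm z.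
Proof. exact: le_bigmax. Qed.

Lemma supnorm_ge0 z : 0 <= supnorm z.
Proof. by rewrite /supnorm; elim/big_ind: _ => // [x y x0 y0|i _]; rewrite ?le_max ?x0 ?cabs_ge0. Qed.

Lemma supnorm_lt z (r : R) : 0 < r -> (forall j, cabs (z 0 j) < r) -> supnorm z < r.
Proof. by move=> r0 h; apply: bigmax_lt. Qed.

Lemma supnorm_le z (r : R) : 0 <= r -> (forall j, cabs (z 0 j) <= r) -> supnorm z <= r.
Proof. by move=> r0 h; apply: bigmax_le. Qed.

Lemma supnormD z w : supnorm (z + w) <= supnorm z + supnorm w.
Proof.
apply: supnorm_le => [|j]; first by rewrite addr_ge0 ?supnorm_ge0.
by rewrite mxE (le_trans (cabsD _ _))// lerD ?supnorm_ge.
Qed.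

Lemma supnormN z : supnorm (- z) = supnorm z.
Proof. by apply: eq_bigr => j _; rewrite mxE cabsN. Qed.

Lemma Cstar_dense z (r : R) : 0 < r -> exists2 w, Cstar w & supnorm (w - z) < r.
Proof.
move=> r0; exists (\row_j (if z 0 j == 0 then (r / 2)%:C else z 0 j)).
  move=> j; rewrite mxE; case: ifPn => // _.
  by rewrite -cabs_gt0 cabs_real normr_gt0 gt_eqF// divr_gt0.
apply: supnorm_lt => // j; rewrite !mxE; case: ifPn => [/eqP ->|_].
  by rewrite subr0 cabs_real ger0_norm; lra.
by rewrite subrr cabs0.
Qed.

Definition logp z : 'rV[R]_n := \row_j ln (Num.max (cabs (z 0 j)) 1).

Lemma posp_logabs z : Cstar z -> posp (logabs z) = logp z.
Proof.
move=> Cz; apply/rowP => j; rewrite !mxE.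
have z0 : 0 < cabs (z 0 j) by rewrite cabs_gt0.
have [h|h] := leP (cabs (z 0 j)) 1.
  by rewrite ln1 max_r// ln_le0.
by rewrite max_l// ln_ge0// ltW.
Qed.

Lemma logp_lip z w j : logp w 0 j <= logp z 0 j + supnorm (w - z).
Proof.
rewrite !mxE; have := supnorm_ge (w - z) j; rewrite !mxE; set d := supnorm _ => h.
have d0 : 0 <= d := supnorm_ge0 _.
have m1 : 1 <= Num.max (cabs (z 0 j)) 1 by rewrite le_max lexx orbT.
set m := Num.max (cabs (z 0 j)) 1 in m1 *.
have mz : cabs (z 0 j) <= m by rewrite le_max lexx.
(* As m >= 1, an additive error d is absorbed by the factor 1 + d, and ln (1 + d) <= d. *)
have hw : Num.max (cabs (w 0 j)) 1 <= m * (1 + d).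
  rewrite ge_max; apply/andP; split; last by nra.
  have : cabs (w 0 j) <= cabs (z 0 j) + d.
    by rewrite -[X in cabs X <= _](subrK (z 0 j)) (le_trans (cabsD _ _))// addrC lerD2l.
  by nra.
apply: (@le_trans _ _ (ln (m * (1 + d)))).
  by rewrite ler_ln ?posrE// ?mulr_gt0 ?lt_max ?ltr01 ?orbT//; lra.
rewrite lnM ?posrE; [|lra|lra].
by rewrite lerD2l le_ln1Dx//; lra.
Qed.

Section fixed_S.
Variable S : set 'rV[R]_n.
Hypotheses (cS : compact S) (SR : S `<=` @Rnplus R n) (S0 : S 0).

Lemma phiS_logp_lip z w :
  phiS S (logp w) <= phiS S (onesv R n) * supnorm (w - z) + phiS S (logp z).
Proof.
apply: (@le_trans _ _ (phiS S (logp z + supnorm (w - z) *: onesv R n))).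
  by apply: phiS_mono => // j; rewrite !mxE mulr1; have := logp_lip z w j; rewrite !mxE.
apply: (le_trans (phiSD _ _ _ _)) => //; rewrite addrC lerD2r mulrC.
by apply: phiSZ => //; exact: supnorm_ge0.
Qed.

(** On the hyperplanes H_S is a limsup over [Cstar], which is dense, so lower semicontinuity of v at
    z transports the bound from [Cstar] to z. *)
Lemma le_HS (v : 'rV[R[i]]_n -> R) z :
  (forall e, 0 < e -> exists2 r, 0 < r & forall w, supnorm (w - z) < r -> v z - e < v w) ->
  (forall w, Cstar w -> v w <= phiS S (logabs w)) -> ((v z)%:E <= HS S z)%E.
Proof.
move=> vl vC; rewrite /HS; case: asboolP => [Cz|_]; first by rewrite lee_fin vC.
apply: le_ereal_inf_tmp => _ [r /= r0 <-].
apply/lee_addgt0Pr => e e0; have [r' r'0 h] := vl e e0.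
have [w Cw] := @Cstar_dense z (Num.min r r') ltac:(by rewrite lt_min r0 r'0).
rewrite lt_min => /andP[wr wr'].
rewrite -leeBlDr//; apply: (@le_trans _ _ (phiS S (logabs w))%:E).
  by rewrite -EFinB lee_fin; apply: le_trans (vC w Cw); exact/ltW/h.
by apply: ereal_sup_ubound; exists w.
Qed.

(** The right-hand side is Lipschitz on all of C^n and agrees with H_S on [Cstar], so it is its own
    limsup extension. *)
Lemma HSE z : (forall xi, phiS S xi = phiS S (posp xi)) -> HS S z = (phiS S (logp z))%:E.
Proof.
move=> H; set sg := phiS S (onesv R n).
have sg0 : 0 <= sg by exact: phiS_ge0.
have HC w : Cstar w -> phiS S (logabs w) = phiS S (logp w).
  by move=> Cw; rewrite H posp_logabs.
apply/eqP; rewrite eq_le; apply/andP; split; last first.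
  apply: (@le_HS (fun z => phiS S (logp z))) => [e e0|w /HC ->//].
  (* The Lipschitz constant [sg] can be 0, as for S = {0}; hence the [+ 1]. *)
  exists (e / (sg + 1)); first by rewrite divr_gt0//; lra.
  move=> w; rewrite ltr_pdivlMr; last lra.
  have := phiS_logp_lip w z; rewrite -/sg -supnormN opprB.
  have := supnorm_ge0 (w - z); nra.
rewrite /HS; case: asboolP => [/HC ->//|_].
apply/lee_addgt0Pr => e e0; rewrite -EFinD.
pose r := e / (sg + 1).
have r0 : 0 < r by rewrite divr_gt0//; lra.
have rE : r * (sg + 1) = e by rewrite divfK// gt_eqF//; lra.
apply: (@le_trans _ _ (ereal_sup [set (phiS S (logabs w))%:E
    | w in [set w | Cstar w /\ supnorm (w - z) < r]])).
  by apply: ereal_inf_lbound; exists r.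
apply: ge_ereal_sup => _ [w [Cw wr] <-]; rewrite lee_fin HC//.
have := phiS_logp_lip z w; rewrite -/sg.
have := supnorm_ge0 (w - z); nra.
Qed.

Lemma HS_translate : (forall xi, phiS S xi = phiS S (posp xi)) -> forall z w,
  (HS S (z - w) <= (phiS S (onesv R n) * supnorm w)%:E + HS S z)%E.
Proof.
move=> H z w; rewrite !HSE// -EFinD lee_fin.
by have := phiS_logp_lip z (z - w); rewrite addrAC subrr add0r supnormN.
Qed.

End fixed_S.
End complex_space.

(** * Jensen's inequality on circles *)

Section jensen.
Context (R : realType).
Local Notation mu := (@lebesgue_measure R).
Local Open Scope complex_scope.
Implicit Types (f g : R -> R) (a b w : R[i]).

Lemma integrable_continuous f (L : R) : continuous f ->
  mu.-integrable `[0, L] (EFin \o f).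
Proof.
move=> cf; apply: continuous_compact_integrable; first exact: segment_compact.
exact: continuous_subspaceT.
Qed.

Lemma integral_EFin_continuous f (L : R) : continuous f ->
  (\int[mu]_(t in `[0%R, L]) (f t)%:E)%E = (\int[mu]_(t in `[0, L]) f t)%:E.
Proof.
move=> cf; rewrite /Rintegral fineK//.
by apply: integrable_fin_num => //; exact: integrable_continuous.
Qed.

Lemma le_Rintegral_continuous f g (L : R) : continuous f -> continuous g ->
  (forall t, f t <= g t) -> \int[mu]_(t in `[0, L]) f t <= \int[mu]_(t in `[0, L]) g t.
Proof.
by move=> cf cg fg; apply: le_Rintegral => //; exact: integrable_continuous.
Qed.

Lemma Rintegral_cst_itv (c L : R) : 0 <= L -> \int[mu]_(t in `[0, L]) (cst c) t = c * L.
Proof.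
move=> L0; rewrite Rintegral_cst//= lebesgue_measure_itv/= lte_fin.
move: L0; rewrite le_eqVlt => /predU1P[<-|->]; first by rewrite ltxx.
by rewrite /= subr0.
Qed.

Lemma Rintegral_shift f (c : R) : continuous f -> 0 <= c ->
  \int[mu]_(t in `[c, c + c]) f t = \int[mu]_(t in `[0, c]) f (t + c).
Proof.
move=> cf c0; rewrite /Rintegral; congr fine.
have D1 : derive1 (fun t : R => t + c) = cst 1.
  by apply/funext => t; rewrite derive1E deriveD// derive_id derive_cst addr0.
have cs : continuous (fun t : R => t + c).
  by move=> t; apply: cvgD => //; exact: cvg_cst.
have := @integration_by_substitution_increasing R (fun t => t + c) f 0 c c0.
rewrite add0r D1 => -> //.
- by apply: eq_integral => x _ /=; rewrite !fctE mulr1.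
- by move=> x y _ _ xy; rewrite ltrD2r.
- by move=> ? ?; exact: cvg_cst.
- exact: is_cvg_cst.
- exact: is_cvg_cst.
- split => /=.
  + by move=> x _; exact: derivableD.
  + by apply: cvg_at_right_filter; exact: cs.
  + by apply: cvg_at_left_filter; exact: cs.
- exact: continuous_subspaceT.
Qed.

Lemma Rintegral_half f (c : R) : continuous f -> 0 <= c ->
  \int[mu]_(t in `[0, c + c]) f t = \int[mu]_(t in `[0, c]) (f t + f (t + c)).
Proof.
move=> cf c0.
have cfc : continuous (fun t => f (t + c)).
  move=> t; apply: (@continuous_comp _ _ _ (fun t => t + c) f); last exact: cf.
  by apply: cvgD => //; exact: cvg_cst.
rewrite RintegralD//; try exact: integrable_continuous.
rewrite -Rintegral_shift//.
have ci := integrable_continuous (c + c) cf.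
have := @Rintegral_itvB R f (BLeft 0) (BRight (c + c)) c ci.
rewrite !bnd_simp lerDl => /(_ c0 c0) E.
have E2 := @Rintegral_itv_obnd_cbnd R c (BRight (c + c)) f.
rewrite -E2; first by rewrite -E [RHS]addrC subrK.
apply: integrableS ci => // x.
by rewrite /= !in_itv/= => /andP[cx ->]; rewrite andbT (le_trans c0)// ltW.
Qed.

Lemma cabs_sq (x y : R) : cabs (x +i* y) ^+ 2 = x ^+ 2 + y ^+ 2.
Proof. by rewrite /cabs /= sqr_sqrtr// addr_ge0// sqr_ge0. Qed.

Lemma cabs_inj_sq a b : cabs a ^+ 2 = cabs b ^+ 2 -> cabs a = cabs b.
Proof. by move=> /eqP; rewrite eqrXn2 ?cabs_ge0// => /eqP. Qed.

Lemma cabs_expi (t : R) : cabs (expi t) = 1.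
Proof. by rewrite /cabs /expi /= cos2Dsin2 sqrtr1. Qed.

Lemma expiD (s t : R) : expi (s + t) = expi s * expi t.
Proof. rewrite /expi cosD sinD; apply/eqP; rewrite eq_complex /=.
by apply/andP; split; apply/eqP; ring. Qed.

(** Dividing by e^{it} gives 1 + e^{-it} w; conjugation restores the exponent +it, so the case |a| <
    |b| of [jensen] meets the same integral as the case |a| > |b|. *)
Lemma cabs_flip (t : R) w : cabs (w + expi t) = cabs (1 + expi t * conjc w).
Proof.
apply: cabs_inj_sq; case: w => x y; rewrite /expi /=.
have := cos2Dsin2 t; move: (cos t) (sin t) => c s cs.
rewrite !sqr_sqrtr ?addr_ge0 ?sqr_ge0//.
have -> : (1 + (c * x - s * - y)) ^+ 2 + (0 + (c * - y + s * x)) ^+ 2 =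
  1 + 2 * (c * x + s * y) + (c ^+ 2 + s ^+ 2) * (x ^+ 2 + y ^+ 2) by ring.
have -> : (x + c) ^+ 2 + (y + s) ^+ 2 = x ^+ 2 + y ^+ 2 + 2 * (c * x + s * y) + (c ^+ 2 + s ^+ 2) by ring.
by rewrite cs; ring.
Qed.

Lemma cvg_cabs_circle (T : Type) (F : set_system T) {FF : Filter F} a b (u : T -> R) (v : R) :
  u x @[x --> F] --> v -> cabs (a + expi (u x) * b) @[x --> F] --> cabs (a + expi v * b).
Proof.
move=> uv; case: a => a1 a2; case: b => b1 b2.
have E t : cabs ((a1 +i* a2)%C + expi t * (b1 +i* b2)%C) =
  Num.sqrt ((a1 + (cos t * b1 - sin t * b2)) ^+ 2 + (a2 + (cos t * b2 + sin t * b1)) ^+ 2) by [].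
under eq_fun do rewrite E; rewrite E.
have cc : cos (u x) @[x --> F] --> cos v.
  by apply: (cvg_comp _ _ uv); exact: continuous_cos.
have cs : sin (u x) @[x --> F] --> sin v.
  by apply: (cvg_comp _ _ uv); exact: continuous_sin.
have kc (k : R) : (fun _ : T => k) @ F --> k by exact: cvg_cst.
apply: (@cvg_comp _ _ _ _ (@Num.sqrt R) _ _ _ _ (@sqrt_continuous R _)).
under eq_fun do rewrite !expr2; rewrite !expr2.
apply: cvgD; apply: cvgM; apply: cvgD => //; first [apply: cvgB|apply: cvgD]; exact: cvgM.
Qed.

Lemma continuous_ln_circle a b (k : R) : (forall t, a + expi t * b != 0) ->
  continuous (fun t => ln (cabs (a + expi (k * t) * b))).
Proof.
move=> ab t.
apply: (@cvg_comp _ _ _ (fun t => cabs (a + expi (k * t) * b)) (@ln R)).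
  apply: cvg_cabs_circle; apply: cvgM; [exact: cvg_cst|exact: cvg_id].
by apply: continuous_ln; rewrite cabs_gt0.
Qed.

Lemma circle_neq0 a b t : cabs a != cabs b -> a + expi t * b != 0.
Proof.
apply: contra => /eqP/(canRL (addrK _)); rewrite sub0r => ->.
by rewrite cabsN cabsM cabs_expi mul1r.
Qed.

Lemma cabs1 : cabs (1 : R[i]) = 1.
Proof. exact: ComplexField.Normc.normc1. Qed.

(* Halving the interval turns w into -w^2, since
   (1 + e w)(1 - e w) = 1 - e^2 w^2; iterating k times leaves an interval of
   length 2c/2^k, on which the integrand is at least ln (1 - rho). *)
Lemma integral_ln_disc (k : nat) (c rho : R) w : 0 < c -> rho < 1 -> cabs w <= rho ->
  2 * c / 2 ^+ k * ln (1 - rho) <=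
  \int[mu]_(t in `[0, c + c]) ln (cabs (1 + expi (pi / c * t) * w)).
Proof.
elim: k c w => [|k IH] c w c0 r1 wr.
  have n0 t : 1 + expi t * w != 0.
    by apply: circle_neq0; rewrite cabs1 gt_eqF//; apply: le_lt_trans r1.
  rewrite expr0 divr1 mulrC (_ : 2 * c = c + c); last by ring.
  have E : \int[mu]_(t in `[0, c + c]) (cst (ln (1 - rho))) t = ln (1 - rho) * (c + c).
    by apply: Rintegral_cst_itv; apply: addr_ge0; exact: ltW.
  rewrite -E.
  apply: le_Rintegral_continuous; [by move=> ?; exact: cvg_cst|exact: continuous_ln_circle|].
  move=> t /=; have p0 : 0 < cabs (1 + expi (pi / c * t) * w) by rewrite cabs_gt0.
  rewrite ler_ln ?posrE//; last by rewrite subr_gt0.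
  have := cabsD (1 + expi (pi / c * t) * w) (- (expi (pi / c * t) * w)).
  rewrite addrK cabs1 cabsN cabsM cabs_expi mul1r; lra.
have n0 t : 1 + expi t * w != 0.
  by apply: circle_neq0; rewrite cabs1 gt_eqF//; apply: le_lt_trans r1.
have n0' t : 1 + expi t * (- w) != 0.
  by apply: circle_neq0; rewrite cabs1 cabsN gt_eqF//; apply: le_lt_trans r1.
rewrite Rintegral_half//; [|exact: continuous_ln_circle|exact: ltW].
have wr2 : cabs (- w ^+ 2) <= rho.
  rewrite cabsN expr2 cabsM; have := cabs_ge0 w; nra.
have := IH (c / 2) (- w ^+ 2) ltac:(by rewrite divr_gt0) r1 wr2.
rewrite -splitr (_ : 2 * (c / 2) / 2 ^+ k = 2 * c / 2 ^+ k.+1); last first.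
  by rewrite exprS; field; rewrite expf_neq0.
move=> /le_trans; apply; rewrite le_eqVlt; apply/orP; left; apply/eqP.
apply: eq_Rintegral => t _.
rewrite -lnM ?posrE ?cabs_gt0// -cabsM; congr (ln (cabs _)).
(* The interval [0, 2c] is one full turn of the phase pi t / c. Halving c doubles the phase, and the
   shift by c turns it by pi, which changes the sign of w. *)
have -> : pi / (c / 2) * t = pi / c * t + pi / c * t by field; rewrite gt_eqF.
have -> : pi / c * (t + c) = pi / c * t + pi by field; rewrite gt_eqF.
rewrite (expiD (_ * t) (_ * t)) (expiD (_ * t) pi); set e := expi _.
have -> : expi (pi : R) = -1.
  by apply/eqP; rewrite eq_complex /= cospi sinpi oppr0 !eqxx.
ring.
Qed.

(** The lower bounds of [integral_ln_disc] at c = pi tend to 0 as k grows. *)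
Lemma integral_ln_disc_ge0 w : cabs w < 1 ->
  0 <= \int[mu]_(t in `[0, 2 * pi]) ln (cabs (1 + expi t * w)).
Proof.
move=> w1; rewrite leNgt; apply/negP; set A := (X in X < 0) => A0.
set C := ln (1 - cabs w).
have H k : 2 * pi * C / 2 ^+ k <= A.
  have := @integral_ln_disc k pi (cabs w) w (pi_gt0 R) w1 (lexx _).
  rewrite (_ : pi + pi = 2 * pi) => [h|]; last by ring.
  have -> : A = \int[mu]_(t in `[0, 2 * pi]) ln (cabs (1 + expi (pi / pi * t) * w)).
    by apply: eq_Rintegral => t _; rewrite divff ?mul1r// gt_eqF// pi_gt0.
  by apply: le_trans h; rewrite mulrAC.
have pi0 := pi_gt0 R.
have := H 0%N; rewrite expr0 divr1 => H0.
have C0 : 0 < 2 * pi * - C by nra.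
have e0 : 0 < - A / (2 * pi * - C) by rewrite divr_gt0// oppr_gt0.
have [N _ /(_ N (leqnn _))] := near_infty_natSinv_expn_lt (PosNum e0).
rewrite /= ltr_pdivlMr// => h.
by have := H N; rewrite -(mul1r (2 * pi * C)) mulrAC; lra.
Qed.

Lemma jensen a b : a != 0 -> cabs a != cabs b ->
  2 * pi * ln (cabs a) <= \int[mu]_(t in `[0, 2 * pi]) ln (cabs (a + expi t * b)).
Proof.
move=> a0 ab.
have pi0 := pi_gt0 R.
have ca0 : 0 < cabs a by rewrite cabs_gt0.
(* Here c is whichever of a and b has the larger modulus: once it is factored out, the remaining
   integral is nonnegative and ln |c| >= ln |a|. *)
have key c w (f : R -> R) : 0 < cabs c -> cabs w < 1 -> cabs a <= cabs c ->
   (forall t, f t = ln (cabs c * cabs (1 + expi t * w))) ->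
   2 * pi * ln (cabs a) <= \int[mu]_(t in `[0, 2 * pi]) f t.
  move=> c0 w1 ac fE.
  have n0 t : 1 + expi t * w != 0 by apply: circle_neq0; rewrite cabs1 gt_eqF.
  have cl : continuous (fun t => ln (cabs (1 + expi t * w))).
    have := @continuous_ln_circle 1 w 1 n0.
    by under eq_fun do rewrite mul1r.
  rewrite (_ : \int[mu]_(t in _) _ =
    \int[mu]_(t in `[0, 2 * pi]) (cst (ln (cabs c)) t + ln (cabs (1 + expi t * w)))); last first.
    by apply: eq_Rintegral => t _; rewrite fE lnM// posrE// cabs_gt0.
  rewrite RintegralD//; last 2 first.
  - by apply: (@integrable_continuous (cst (ln (cabs c)))) => ?; exact: cvg_cst.
  - exact: integrable_continuous.
  rewrite Rintegral_cst_itv; last by rewrite mulr_ge0// ltW.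
  have := integral_ln_disc_ge0 w1.
  have : ln (cabs a) <= ln (cabs c) by rewrite ler_ln ?posrE.
  by move=> h1 h2; nra.
have [h|h] := ltP (cabs b) (cabs a).
  apply: (key a (b / a)) => // [|t].
    by rewrite cabsM [cabs a^-1]ComplexField.Normc.normcV -/(cabs a) ltr_pdivrMr// mul1r.
  rewrite -cabsM mulrDr mulr1; congr (ln (cabs (_ + _))).
  by rewrite mulrCA [a * _]mulrC divfK.
have {h} ab' : cabs a < cabs b by rewrite lt_neqAle ab.
have b0 : 0 < cabs b by apply: le_lt_trans ab'; exact: cabs_ge0.
apply: (key b (conjc (a / b))) => // [||t]; [|exact: ltW|].
  have -> : cabs (conjc (a / b)) = cabs (a / b).
    by case: (a / b) => x y; rewrite /cabs /= sqrrN.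
  by rewrite cabsM [cabs b^-1]ComplexField.Normc.normcV -/(cabs b) ltr_pdivrMr// mul1r.
rewrite -cabs_flip -cabsM mulrDr; congr (ln (cabs (_ + _))).
  by rewrite mulrC divfK// -cabs_gt0.
by rewrite mulrC.
Qed.

End jensen.

(** * The functions log^+ |z^s| *)

Section monomial.
Context (R : realType).
Local Notation mu := (@lebesgue_measure R).
Local Open Scope complex_scope.

Lemma cabs_dist (a b : R[i]) : `|cabs a - cabs b| <= cabs (a - b).
Proof.
have h1 := cabsD (a - b) b; have h2 := cabsD (b - a) a.
by rewrite !subrK in h1 h2; rewrite (cabsB b) in h2; rewrite ler_norml; lra.
Qed.

Lemma cvg_powR (T : Type) (F : set_system T) {FF : Filter F} (u : T -> R) (l s : R) :
  0 <= s -> (forall x, 0 <= u x) -> 0 <= l -> u x @[x --> F] --> l ->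
  (u x `^ s) @[x --> F] --> l `^ s.
Proof.
rewrite le_eqVlt => /predU1P[<-|s0] u0 l0 ul.
  by under eq_fun do rewrite powRr0; rewrite powRr0; exact: cvg_cst.
move: l0; rewrite le_eqVlt => /predU1P[l0|l0]; last first.
  have : expR (s * ln (u x)) @[x --> F] --> expR (s * ln l).
    apply: (@cvg_comp _ _ _ (fun x => s * ln (u x)) (@expR R)); last exact: continuous_expR.
    apply: cvgM; first exact: cvg_cst.
    by apply: (cvg_comp _ _ ul); exact: continuous_ln.
  rewrite [in X in _ -> _ --> X]/powR gt_eqF//; apply: cvg_trans.
  apply: near_eq_cvg; near=> x; rewrite /powR gt_eqF//.
  by near: x; exact: (cvgr_gt l ul).
rewrite -l0 powR0 ?gt_eqF//; apply/cvgrPdist_lt => e e0; near=> x.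
rewrite sub0r normrN ger0_norm ?powR_ge0//.
have -> : e = (e `^ s^-1) `^ s by rewrite -powRrM mulVf ?gt_eqF// powRr1// ltW.
apply: gt0_ltr_powR; rewrite ?nnegrE ?powR_ge0//.
near: x; apply: filterS (cvgr_lt l ul (e `^ s^-1) _) => //.
by rewrite -l0 powR_gt0.
Unshelve. all: by end_near. Qed.

Lemma cvg_prodr (T : Type) (F : set_system T) {FF : Filter F} (m : nat)
    (f : 'I_m -> T -> R) (l : 'I_m -> R) :
  (forall i, f i x @[x --> F] --> l i) ->
  (\prod_(i < m) f i x) @[x --> F] --> \prod_(i < m) l i.
Proof.
elim: m f l => [|m IH] f l h.
  by under eq_fun do rewrite big_ord0; rewrite big_ord0; exact: cvg_cst.
under eq_fun do rewrite big_ord_recl; rewrite big_ord_recl.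
by apply: cvgM; [exact: h|apply: IH => i; exact: h].
Qed.

Lemma Rintegral_sum_continuous (m : nat) (f : 'I_m -> R -> R) (L : R) :
  (forall i, continuous (f i)) ->
  \int[mu]_(t in `[0, L]) (\sum_(i < m) f i t) = \sum_(i < m) \int[mu]_(t in `[0, L]) f i t /\
  continuous (fun t => \sum_(i < m) f i t).
Proof.
elim: m f => [|m IH] f cf.
  rewrite big_ord0 (_ : (fun t => _) = cst 0); last by apply/funext => t; rewrite big_ord0.
  by split; [rewrite /Rintegral integral0|move=> t; exact: cvg_cst].
have [I1 I2] := IH (fun i => f (lift ord0 i)) (fun i => cf _).
rewrite (_ : (fun t => _) = (fun t => f ord0 t + \sum_(i < m) f (lift ord0 i) t)); last first.
  by apply/funext => t; rewrite big_ord_recl.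
rewrite big_ord_recl -I1; split; last by move=> t; apply: cvgD; [exact: cf|exact: I2].
by rewrite RintegralD//; apply: integrable_continuous.
Qed.

Lemma ln_prod (m : nat) (f : 'I_m -> R) : (forall i, 0 < f i) ->
  ln (\prod_(i < m) f i) = \sum_(i < m) ln (f i).
Proof.
move=> f0.
suff [] : 0 < \prod_(i < m) f i /\ ln (\prod_(i < m) f i) = \sum_(i < m) ln (f i) by [].
elim: m f f0 => [|m IH] f f0; first by rewrite !big_ord0 ln1.
have [I1 I2] := IH (fun i => f (lift ord0 i)) (fun i => f0 _).
by rewrite !big_ord_recl mulr_gt0// lnM ?posrE// I2.
Qed.

Variable n : nat.
Implicit Types (s : 'rV[R]_n) (z w : 'rV[R[i]]_n).

Definition mono s z : R := \prod_(j < n) (cabs (z 0 j) `^ s 0 j).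

Definition logmono s z : R := ln (Num.max 1 (mono s z)).

Lemma logmono_ge0 s z : 0 <= logmono s z.
Proof. by rewrite ln_ge0// le_max lexx. Qed.

Lemma ln_mono s z : (forall j, s 0 j != 0 -> z 0 j != 0) ->
  0 < mono s z /\ ln (mono s z) = \sum_(j < n) s 0 j * ln (cabs (z 0 j)).
Proof.
move=> sz.
have p0 j : 0 < cabs (z 0 j) `^ s 0 j.
  have [->|/sz] := eqVneq (s 0 j) 0; first by rewrite powRr0.
  by rewrite -cabs_gt0; exact: powR_gt0.
split; first by apply: prodr_gt0 => j _.
by rewrite ln_prod//; apply: eq_bigr => j _; rewrite ln_powR.
Qed.

Lemma logmono_ge s z : (forall j, s 0 j != 0 -> z 0 j != 0) ->
  \sum_(j < n) s 0 j * ln (cabs (z 0 j)) <= logmono s z.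
Proof.
move=> /ln_mono[m0 <-]; rewrite /logmono ler_ln ?posrE//.
  by rewrite le_max lexx orbT.
by rewrite lt_max m0 orbT.
Qed.

Lemma logmono_gt1 s z : 1 < mono s z ->
  logmono s z = \sum_(j < n) s 0 j * ln (cabs (z 0 j)) /\
  forall j, s 0 j != 0 -> z 0 j != 0.
Proof.
move=> m1.
have sz j : s 0 j != 0 -> z 0 j != 0.
  move=> sj; apply/eqP => zj; move: m1.
  by rewrite /mono (bigD1 j)//= zj cabs0 powR0// mul0r ltr10.
split => //; have [_ <-] := ln_mono sz.
by rewrite /logmono max_r// ltW.
Qed.

Lemma logmono_le1 s z : mono s z <= 1 -> logmono s z = 0.
Proof. by move=> m1; rewrite /logmono max_l// ln1. Qed.

Lemma logmono_le s z : Rnplus s -> logmono s z <= \sum_(j < n) s 0 j * cabs (z 0 j).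
Proof.
move=> s0; have [/logmono_le1 ->|/logmono_gt1[-> sz]] := leP (mono s z) 1.
  by apply: sumr_ge0 => j _; rewrite mulr_ge0// cabs_ge0.
apply: ler_sum => j _; have [->|/sz] := eqVneq (s 0 j) 0; first by rewrite !mul0r.
by rewrite -cabs_gt0 => z0; rewrite ler_wpM2l// ltW// ln_sublinear.
Qed.

Lemma cvg_logmono (T : Type) (F : set_system T) {FF : Filter F} (z_ : T -> 'rV[R[i]]_n) s z :
  Rnplus s -> (forall j, cabs (z_ x 0 j) @[x --> F] --> cabs (z 0 j)) ->
  logmono s (z_ x) @[x --> F] --> logmono s z.
Proof.
move=> s0 cz.
have cm : mono s (z_ x) @[x --> F] --> mono s z.
  apply: cvg_prodr => j; apply: cvg_powR => //.
  - by move=> x; exact: cabs_ge0.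
  - exact: cabs_ge0.
apply: (@cvg_comp _ _ _ (fun x => Num.max 1 (mono s (z_ x))) (@ln R)); last first.
  by apply: continuous_ln; rewrite lt_max ltr01.
apply/cvgrPdist_lt => e e0; near=> x.
have : `|mono s z - mono s (z_ x)| < e by near: x; exact: cvgr_dist_lt.
rewrite !ltr_norml /Num.max; do 2 case: ifPn; rewrite -?leNgt; lra.
Unshelve. all: by end_near. Qed.

Lemma logmono_continuous s z (e : R) : Rnplus s -> 0 < e -> exists2 r : R, 0 < r &
  forall w, supnorm (w - z) < r -> `|logmono s w - logmono s z| < e.
Proof.
move=> s0 e0; apply: contrapT => H.
have {}H k : exists w, supnorm (w - z) < k.+1%:R^-1 /\ ~ `|logmono s w - logmono s z| < e.
  apply: contrapT => H'; apply: H; exists k.+1%:R^-1; first by rewrite invr_gt0.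
  by move=> w h1; apply: contrapT => h2; apply: H'; exists w.
have [w_ Hw] := choice H.
have : logmono s (w_ k) @[k --> \oo] --> logmono s z.
  apply: cvg_logmono => // j; apply/cvgrPdist_lt => d d0; near=> k.
  apply: (@le_lt_trans _ _ (supnorm (w_ k - z))).
    apply: le_trans (supnorm_ge _ j); rewrite !mxE distrC; exact: cabs_dist.
  have [h _] := Hw k; apply: (lt_trans h).
  by near: k; exact: near_infty_natSinv_lt (PosNum d0).
move/cvgrPdist_lt => /(_ e e0)[N _ /(_ N (leqnn N))].
by rewrite /= distrC; have [] := Hw N.
Unshelve. all: by end_near. Qed.

Lemma logmono_le_phiS (S : set 'rV[R]_n) s z : compact S -> S s -> Rnplus s -> S 0 -> Cstar z ->
  logmono s z <= phiS S (logabs z).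
Proof.
move=> cS Ss s0 S0 Cz.
have [/logmono_le1 ->|/logmono_gt1[-> _]] := leP (mono s z) 1; first exact: phiS_ge0.
have := phiS_ub cS S0 (logabs z) Ss; rewrite /inner.
by under eq_bigr do rewrite mxE.
Qed.

Lemma continuous_logmono_circle s (a b : 'rV[R[i]]_n) : Rnplus s ->
  continuous (fun t => logmono s (a + expi t *: b)).
Proof.
move=> s0 t; apply: cvg_logmono => // j.
under eq_fun do rewrite !mxE; rewrite !mxE.
by apply: cvg_cabs_circle; exact: cvg_id.
Qed.

(* When |a_j| <> |b_j| the circle avoids the zeros, where [ln 0 = 0] would
   spoil the pointwise lower bound by the sum of the s_j ln|z_j|. *)
Lemma logmono_submean_generic s (a b : 'rV[R[i]]_n) : Rnplus s -> 1 < mono s a ->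
  (forall j, s 0 j != 0 -> cabs (a 0 j) != cabs (b 0 j)) ->
  2 * pi * logmono s a <= \int[mu]_(t in `[0, 2 * pi]) logmono s (a + expi t *: b).
Proof.
move=> s0 /logmono_gt1[-> sa] ab.
pose h j t := if s 0 j == 0 then 0 else s 0 j * ln (cabs (a 0 j + expi t * b 0 j)).
have cl j : s 0 j != 0 -> continuous (fun t => ln (cabs (a 0 j + expi t * b 0 j))).
  move=> sj; have n0 t : a 0 j + expi t * b 0 j != 0 by apply: circle_neq0; exact: ab.
  have := @continuous_ln_circle _ (a 0 j) (b 0 j) 1 n0.
  by under eq_fun do rewrite mul1r.
have ch j : continuous (h j).
  rewrite /h; have [_|sj] := eqVneq (s 0 j) 0; first by move=> t; exact: cvg_cst.
  by move=> t; apply: cvgM; [exact: cvg_cst|exact: cl].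
have [I1 I2] := Rintegral_sum_continuous (2 * pi) ch.
apply: (@le_trans _ _ (\int[mu]_(t in `[0, 2 * pi]) (\sum_(j < n) h j t))); last first.
  apply: le_Rintegral_continuous => //; first exact: continuous_logmono_circle.
  move=> t; apply: le_trans (logmono_ge _).
    by apply: ler_sum => j _; rewrite /h !mxE; case: eqP => // ->; rewrite mul0r.
  by move=> j sj; rewrite !mxE; apply: circle_neq0; exact: ab.
rewrite I1 mulr_sumr; apply: ler_sum => j _; rewrite /h.
have [->|sj] := eqVneq (s 0 j) 0; first by rewrite mul0r mulr0 /Rintegral integral0.
rewrite RintegralZl//; last by apply: integrable_continuous; exact: cl.
rewrite mulrCA ler_wpM2l//; apply: jensen; [exact: sa|exact: ab].
Qed.

(** Each j with s_j <> 0 excludes at most one radius, because a_j <> 0; finitely many exclusions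
    leave every rho close enough to 1 from the right. *)
Lemma generic_radius s (a b : 'rV[R[i]]_n) (k : nat) : (forall j, s 0 j != 0 -> a 0 j != 0) ->
  exists rho : R, [/\ 1 < rho, rho < 1 + k.+1%:R^-1 &
    forall j, s 0 j != 0 -> cabs (a 0 j) != rho * cabs (b 0 j)].
Proof.
move=> sa.
have : \forall rho \near (1:R)^'+, [/\ 1 < rho, rho < 1 + k.+1%:R^-1 &
    forall j, s 0 j != 0 -> cabs (a 0 j) != rho * cabs (b 0 j)].
  have H1 : \forall rho \near (1:R)^'+, forall j, s 0 j != 0 -> cabs (a 0 j) != rho * cabs (b 0 j).
    apply: filter_forall => j.
    have [sj|sj] := eqVneq (s 0 j) 0; first exact: nearW.
    have a0 : 0 < cabs (a 0 j) by rewrite cabs_gt0 sa.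
    have [ba|ab] := ltP (cabs (b 0 j)) (cabs (a 0 j)); last first.
      near=> rho => _; rewrite lt_eqF//.
      have r1 : 1 < rho by [].
      by nra.
    have [b0|b0] := eqVneq (cabs (b 0 j)) 0; first by apply: nearW => rho _; rewrite b0 mulr0 gt_eqF.
    have b0' : 0 < cabs (b 0 j) by rewrite lt_neqAle eq_sym b0 cabs_ge0.
    near=> rho => _; rewrite gt_eqF// -ltr_pdivlMr//.
    by near: rho; apply: nbhs_right_lt; rewrite ltr_pdivlMr// mul1r.
  near=> rho; split; [by []| |by near: rho].
  by near: rho; apply: nbhs_right_lt; rewrite ltrDl invr_gt0.
by move=> /filter_ex[rho ?]; exists rho.
Unshelve. all: by end_near. Qed.

(** Generic radii rho_k decreasing the problem to circles off the zeros converge to 1, and reverse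
    Fatou would carry a strict failure on the original circle over to the circle of some rho_k. *)
Lemma logmono_submean s (a b : 'rV[R[i]]_n) : Rnplus s ->
  2 * pi * logmono s a <= \int[mu]_(t in `[0, 2 * pi]) logmono s (a + expi t *: b).
Proof.
move=> s0; have pi0 := pi_gt0 R.
have [/logmono_le1 ->|m1] := leP (mono s a) 1.
  by rewrite mulr0; apply: Rintegral_ge0 => t _; exact: logmono_ge0.
have [_ sa] := logmono_gt1 m1.
have [rho Hr] := choice (fun k => generic_radius b k sa).
rewrite leNgt; apply/negP => lt.
pose D : set R := `[0, 2 * pi]%classic.
pose b_ k := (rho k)%:C *: b.
have cg c : continuous (fun t => logmono s (a + expi t *: c)) by exact: continuous_logmono_circle.
(* The bound of [logmono_le], uniform over the circles in play since rho k <= 2. *)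
pose M := \sum_(j < n) s 0 j * (cabs (a 0 j) + 2 * cabs (b 0 j)).
have M0 : 0 <= M.
  by apply: sumr_ge0 => j _; rewrite mulr_ge0// addr_ge0 ?mulr_ge0// cabs_ge0.
pose G (c : 'rV[R[i]]_n) := (fun t => (logmono s (a + expi t *: c))%:E) \_ D : R -> \bar R.
have GD c t : t \in D -> G c t = (logmono s (a + expi t *: c))%:E by rewrite /G /patch => ->.
have GnD c t : t \notin D -> G c t = 0%E by rewrite /G /patch => /negbTE ->.
have GE (c : 'rV[R[i]]_n) : (\int[mu]_t G c t = (\int[mu]_(t in D) logmono s (a + expi t *: c))%:E)%E.
  by rewrite /G -integral_mkcond integral_EFin_continuous.
have bG (c : 'rV[R[i]]_n) : (forall j, cabs (c 0 j) <= 2 * cabs (b 0 j)) -> ub_supp (2 * pi) M (G c).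
  move=> cb; split.
  - have mD : measurable (D : set (measurableTypeR R)) by exact: measurable_itv.
    apply/(measurable_restrictT _ mD).
    apply/measurable_EFinP; apply: measurable_funTS; exact: continuous_measurable_fun.
  - move=> t; rewrite /G /patch; case: ifP => _; last by rewrite lee_fin.
    rewrite lee_fin; apply: (le_trans (logmono_le _ s0)); apply: ler_sum => j _.
    rewrite ler_wpM2l// !mxE (le_trans (cabsD _ _))// lerD2l cabsM cabs_expi mul1r.
    exact: cb.
  - move=> t tp; rewrite /G /patch; case: ifPn => // /set_mem; rewrite /D/= in_itv/= => /andP[t0 t2].
    by exfalso; move: tp; rewrite ger0_norm//; lra.
have cb_ k j : cabs (b_ k 0 j) = rho k * cabs (b 0 j).
  by rewrite mxE cabsM cabs_real ger0_norm//; have [r1 _ _] := Hr k; rewrite ltW// (lt_trans ltr01).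
have rho2 k : rho k <= 2.
  have [_ h _] := Hr k; apply/ltW/(lt_le_trans h).
  by rewrite -[2]/(1 + 1) lerD2l invf_le1 ?ler1n.
have := @ub_supp_fatou R (2 * pi) M (fun k => G (b_ k)) (G b) (2 * pi * logmono s a) _ M0.
case.
- by rewrite mulr_ge0// ltW.
- by move=> k; apply: bG => j; rewrite cb_ ler_wpM2r ?cabs_ge0.
- by apply: bG => j; have := cabs_ge0 (b 0 j); lra.
- move=> t c; have [tD|tD] := boolP (t \in D); last first.
    by rewrite GnD// => h; apply: nearW => k; rewrite GnD.
  rewrite GD// lte_fin => h.
  have : logmono s (a + expi t *: b_ k) @[k --> \oo] --> logmono s (a + expi t *: b).
    apply: cvg_logmono => // j.
    apply/cvgrPdist_lt => d d0.
    have cb0 := cabs_ge0 (b 0 j).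
    have dd : 0 < d / (cabs (b 0 j) + 1) by rewrite divr_gt0//; lra.
    near=> k.
    rewrite distrC; apply: (le_lt_trans (cabs_dist _ _)).
    rewrite !mxE opprD addrACA subrr add0r -mulrBr cabsM cabs_expi mul1r.
    have -> : (rho k)%:C * b 0 j - b 0 j = (rho k - 1)%:C * b 0 j.
      by rewrite rmorphB rmorph1 mulrBl mul1r.
    rewrite cabsM cabs_real.
    have [r1 r2 _] := Hr k; rewrite ger0_norm ?subr_ge0 ?(ltW r1)//.
    have : k.+1%:R^-1 < d / (cabs (b 0 j) + 1).
      by near: k; exact: near_infty_natSinv_lt (PosNum dd).
    rewrite ltr_pdivlMr => [hd|]; last lra.
    have k0 : 0 < k.+1%:R^-1 :> R by rewrite invr_gt0.
    have h4 : rho k - 1 <= k.+1%:R^-1 by rewrite lerBlDl ltW.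
    have := ler_wpM2r cb0 h4.
    rewrite mulrDr mulr1 in hd; move=> h3; apply: le_lt_trans h3 _.
    by apply: le_lt_trans hd; rewrite lerDl ltW.
  by move=> /(cvgr_lt _)/(_ _ h); apply: filterS => k hk; rewrite GD// lte_fin.
- by rewrite GE lte_fin.
move=> N _ /(_ N (leqnn _)) /=; rewrite GE lte_fin ltNge => /negP; apply.
apply: logmono_submean_generic => // j sj.
by rewrite cb_; have [_ _] := Hr N; exact.
Unshelve. all: by end_near. Qed.

Lemma logmono_psh s : Rnplus s -> psh (fun z => (logmono s z)%:E).
Proof.
move=> s0; split; first by move=> z; exact: ltry.
- move=> z c; rewrite lte_fin => zc.
  have [r r0 h] := logmono_continuous z s0 (etrans (subr_gt0 _ _) zc).
  exists r => // w /h; rewrite ltr_norml lte_fin => /andP[_]; lra.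
- move=> a b; rewrite integral_EFin_continuous; last exact: continuous_logmono_circle.
  have pi0 := pi_gt0 R.
  rewrite -EFinM lee_fin ler_pdivlMl ?mulr_gt0//; exact: logmono_submean.
Qed.

Lemma logmono_LS (S : set 'rV[R]_n) s : compact S -> S `<=` @Rnplus R n -> S 0 -> S s ->
  LS S (fun z => (logmono s z)%:E).
Proof.
move=> cS SR S0 Ss; have s0 := SR _ Ss.
split; first exact: logmono_psh.
exists 0 => z; rewrite add0e; apply: le_HS => [e e0|w Cw].
- have [r r0 h] := logmono_continuous z s0 e0; exists r => // w /h.
  rewrite ltr_norml => /andP[]; lra.
- exact: logmono_le_phiS.
Qed.

(** Adding 1 to z_j = exp(t xi_j) gives a modulus of at least exp(t xi_j^+), so the translate of
    log^+ |z^s| sees xi^+ at a point where H_S sees only xi. *)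
Lemma translate_phiS (S : set 'rV[R]_n) : compact S -> S `<=` @Rnplus R n -> S 0 ->
  (forall u, LS S u -> forall w, LS S (fun z => u (z - w))) ->
  forall xi, phiS S xi = phiS S (posp xi).
Proof.
move=> cS SR S0 H xi; apply/eqP; rewrite eq_le phiS_mono/=; [|exact: cS|exact: SR|by []|exact: le_posp].
have [s [Ss -> _]] := phiSP (posp xi) cS (ex_intro _ _ S0).
have [_ [c hc]] := H _ (logmono_LS cS SR S0 Ss) (const_mx (-1)).
have s0 := SR _ Ss.
have key (t : R) : 0 < t -> t * inner s (posp xi) <= c + t * phiS S xi.
  move=> t0; pose z : 'rV[R[i]]_n := \row_j (expR (t * xi 0 j))%:C.
  have cz j : cabs (z 0 j) = expR (t * xi 0 j) by rewrite mxE cabs_real ger0_norm ?expR_ge0.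
  have Cz : Cstar z by move=> j; rewrite -cabs_gt0 cz expR_gt0.
  have lz : logabs z = t *: xi by apply/rowP => j; rewrite [LHS]mxE cz expRK mxE.
  have := hc z; rewrite /HS; case: asboolP => // _; rewrite lz -EFinD lee_fin.
  have czm j : cabs ((z - const_mx (-1)) 0 j) = expR (t * xi 0 j) + 1.
    have E : (expR (t * xi 0 j))%:C + 1 = (expR (t * xi 0 j) + 1)%:C :> R[i] by rewrite rmorphD.
    by rewrite !mxE opprK E cabs_real ger0_norm// addr_ge0// expR_ge0.
  move=> h; have hp := phiSZ cS S0 xi (ltW t0).
  apply: (@le_trans _ _ (logmono s (z - const_mx (-1)))); last lra.
  apply: le_trans (logmono_ge _).
    rewrite /inner mulr_sumr; apply: ler_sum => j _.
    rewrite mulrCA ler_wpM2l// czm mxE.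
    have e0 := expR_gt0 (t * xi 0 j).
    have [x0|x0] := leP (xi 0 j) 0.
      by rewrite mulr0 ln_ge0//; lra.
    by rewrite -[leLHS]expRK ler_ln ?posrE; lra.
  by move=> j _; rewrite -cabs_gt0 czm; have := expR_gt0 (t * xi 0 j); lra.
rewrite leNgt; apply/negP; set A := inner _ _; set B := phiS S xi => BA.
(* This t makes t (A - B) = |c| + 1, which exceeds c. *)
have := key ((`|c| + 1) / (A - B)) _; rewrite divr_gt0; [|have := normr_ge0 c; lra|lra].
move=> /(_ erefl); have AB : A - B != 0 by rewrite gt_eqF//; lra.
have E : (`|c| + 1) / (A - B) * (A - B) = `|c| + 1 by rewrite divfK.
have := ler_norm c; rewrite -/A -/B; rewrite mulrBr in E; lra.
Qed.

End monomial.

(** * A smooth bump function *)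

Section flat_exponential.
Context (R : realType).

(* t^-k exp(-1/t) on t > 0: the derivatives of [flat 0] are combinations of these. *)
Definition flat (k : nat) (t : R) : R := if 0 < t then expR (- t^-1) * t^-1 ^+ k else 0.

Lemma flat_le0 k t : t <= 0 -> flat k t = 0.
Proof. by rewrite /flat ltNge => ->. Qed.

Lemma flat_ge0 k t : 0 <= flat k t.
Proof.
rewrite /flat; case: ifP => // t0.
by rewrite mulr_ge0 ?expR_ge0// exprn_ge0// invr_ge0 ltW.
Qed.

(** One term of the exponential series: exp(1/t) >= t^-(k+1) / (k+1)!. A linear bound is enough for
    differentiability at 0, since [flat k h / h = flat k.+1 h] for h > 0. *)
Lemma flat_le k (t : R) : 0 <= t -> flat k t <= k.+1`!%:R * t.
Proof.
rewrite le_eqVlt => /predU1P[<-|t0]; first by rewrite /flat ltxx mulr0.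
rewrite /flat t0 expRN; set y := t^-1.
have y0 : 0 < y by rewrite invr_gt0.
have e0 := expR_gt0 y.
have F0 : 0 < (k.+1`!%:R : R) by rewrite ltr0n fact_gt0.
rewrite mulrC ler_pdivrMr// -mulrA mulrCA.
have tE : t = y^-1 by rewrite invrK.
rewrite tE ler_pdivlMl// -exprS.
rewrite -ler_pdivrMl// mulrC; apply: le_trans (expR_ge1Dxn k (ltW y0)).
by rewrite lerDr.
Qed.

Lemma flat0_le1 t : flat 0 t <= 1.
Proof.
rewrite /flat; case: ifP => // t0; rewrite expr0 mulr1 -expR0 ler_expR.
by rewrite oppr_le0 invr_ge0 ltW.
Qed.

Lemma is_derive_flat0 k : is_derive (0 : R) (1 : R) (flat k) 0.
Proof.
have C : h^-1 *: ((flat k \o shift 0) (h *: (1 : R)) - flat k 0) @[h --> (0 : R)^'] --> (0 : R).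
  apply/cvgrPdist_lt => e e0; near=> h.
  rewrite sub0r normrN /= addr0 [h *: 1]mulr1 {2}/flat ltxx subr0.
  have h0 : h != 0 by near: h; exact: nbhs_dnbhs_neq.
  have F0 : 0 < (k.+2`!%:R : R) by rewrite ltr0n fact_gt0.
  have he : `|h| < e / k.+2`!%:R by near: h; apply: dnbhs0_lt; rewrite divr_gt0.
  move: h0; rewrite neq_lt => /orP[hn|hp].
    by rewrite flat_le0 ?(ltW hn)// scaler0 normr0.
  have -> : h^-1 *: flat k h = flat k.+1 h.
    by rewrite /flat hp exprS mulrCA.
  rewrite ger0_norm ?flat_ge0//; apply: le_lt_trans (flat_le _ (ltW hp)) _.
  by rewrite mulrC -ltr_pdivlMr// -(ger0_norm (ltW hp)).
by apply: DeriveDef; [apply/cvg_ex; exists 0|exact: cvg_lim].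
Unshelve. all: by end_near. Qed.

Lemma is_derive_flat (k : nat) (t : R) :
  is_derive t (1 : R) (flat k) (flat k.+2 t - k%:R * flat k.+1 t).
Proof.
have [t0|t0|->] := ltgtP t 0.
- have -> : flat k.+2 t - k%:R * flat k.+1 t = 0.
    by rewrite !flat_le0 ?ltW// mulr0 subr0.
  have d0 : is_derive t (1 : R) (cst (0 : R) : R -> R) (0 : R) by exact: is_derive_cst.
  apply: near_eq_is_derive d0; near=> u; rewrite flat_le0//; apply: ltW; near: u.
  exact: lt_nbhsl.
- pose g (u : R) := expR (- u^-1) * u^-1 ^+ k.
  apply: (@near_eq_is_derive _ _ _ g).
    near=> u; rewrite /flat /g ifT//; near: u.
    exact: lt_nbhsr.
  have tn : t != 0 by rewrite gt_eqF.
  have d1 : is_derive t (1 : R) (fun u : R => u^-1) (- t ^- 2 *: (1 : R)).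
    exact: (@is_deriveV _ id).
  have d2 : is_derive t (1 : R) (fun u : R => - u^-1) (- (- t ^- 2 *: (1 : R))).
    exact: is_deriveN.
  have d3 : is_derive t (1 : R) (expR \o (fun u : R => - u^-1)) (expR (- t^-1) * (- (- t ^- 2 *: (1 : R)))).
    exact: is_derive1_comp.
  have d4 := is_deriveX k d1.
  have d5 := is_deriveM d3 d4.
  have -> : g = (expR \o (fun u : R => - u^-1)) * (fun u : R => u^-1) ^+ k.
    by apply/funext => u; rewrite /g !fctE.
  apply: (is_derive_eq d5).
  rewrite /flat t0 /=; set E := expR _.
  rewrite -![_ *: 1]/(_ * 1) !mulr1 -![_ *: (_ : R)]/(_ * _).
  rewrite -exprVn; set y := t^-1.
  rewrite [X in _ + X * _](_ : _ = y ^+ k); last by rewrite fctE.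
  case: k {d4 d5 g} => [|k].
    by rewrite !mul0r; ring.
  by rewrite /= !exprS; ring.
- rewrite !flat_le0// mulr0 subr0; exact: is_derive_flat0.
Unshelve. all: by end_near. Qed.

End flat_exponential.

Section smooth_bump.
Context (R : realType) (m : nat).
Local Notation W := ('rV[R]_m).

Definition sqn (x : W) : R := 1 - \sum_(i < m) x 0 i * x 0 i.

(* An algebra containing the bump function and stable under derivation. *)
Inductive bump_alg : (W -> R) -> Prop :=
| bump_alg_cst c : bump_alg (fun=> c)
| bump_alg_coord i : bump_alg (fun x => x 0 i)
| bump_alg_add f g : bump_alg f -> bump_alg g -> bump_alg (f + g)
| bump_alg_mul f g : bump_alg f -> bump_alg g -> bump_alg (f * g)
| bump_alg_flat k : bump_alg (flat k \o sqn).

Lemma bump_alg_sum p (f : 'I_p -> W -> R) : (forall i, bump_alg (f i)) -> bump_alg (fun x => \sum_(i < p) f i x).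
Proof.
elim: p f => [|p IH] f sf.
  rewrite (_ : (fun x => _) = fun=> 0); first exact: bump_alg_cst.
  by apply/funext => x; rewrite big_ord0.
rewrite (_ : (fun x => _) = f ord0 + (fun x => \sum_(i < p) f (lift ord0 i) x)).
  by apply: bump_alg_add => //; exact: IH.
by apply/funext => x; rewrite big_ord_recl.
Qed.

Lemma differentiable_sqn (x : W) : differentiable sqn x.
Proof.
rewrite (_ : sqn = cst 1 - \sum_(i < m) ((fun x : W => x 0 i) * (fun x : W => x 0 i))).
  apply: differentiableB => //; apply: differentiable_sum => i.
  by apply: differentiableM; exact: differentiable_coord.
by apply/funext => y; rewrite /sqn !fctE fct_sumE.
Qed.

Lemma differentiable_bump_alg f (x : W) : bump_alg f -> differentiable f x.
Proof.
elim=> [c|i|{}f g _ df _ dg|{}f g _ df _ dg|k].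
- exact: differentiable_cst.
- exact: differentiable_coord.
- exact: differentiableD.
- exact: differentiableM.
- apply: differentiable_comp; first exact: differentiable_sqn.
  by apply/derivable1_diffP; have [] := is_derive_flat k (sqn x).
Qed.

Lemma derive_coord (x v : W) i : 'D_v (fun x : W => x 0 i) x = v 0 i.
Proof.
rewrite /derive; apply: cvg_lim => //.
have E : (fun _ : R => v 0 i) h @[h --> (0 : R)^'] --> v 0 i by exact: cvg_cst.
apply: cvg_trans E; apply: near_eq_cvg; near=> h.
have h0 : h != 0 by near: h; exact: nbhs_dnbhs_neq.
by rewrite /= !mxE addrK -[_ *: _]/(_ * _) mulKf.
Unshelve. all: by end_near. Qed.

Lemma derive_sqn (v : W) : bump_alg ('D_v sqn).
Proof.
rewrite (_ : 'D_v sqn = (fun=> -1) * (fun x => \sum_(i < m) ((fun=> 2 * v 0 i) * (fun x : W => x 0 i)) x)).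
  apply: bump_alg_mul; first exact: bump_alg_cst.
  apply: bump_alg_sum => i; apply: bump_alg_mul; [exact: bump_alg_cst|exact: bump_alg_coord].
apply/funext => x.
pose c i : W -> R := fun x => x 0 i.
have dc i : derivable (c i) x v by apply: diff_derivable; exact: differentiable_coord.
have dcc i : derivable (c i * c i) x v.
  by apply: diff_derivable; apply: differentiableM; exact: differentiable_coord.
have -> : sqn = cst 1 - \sum_(i < m) (c i * c i).
  by apply/funext => y; rewrite /sqn !fctE fct_sumE.
rewrite deriveB//; last by apply: derivable_sum.
rewrite derive_cst derive_sum// sub0r !fctE mulN1r; congr (- _).
apply: eq_bigr => i _; rewrite deriveM//.
have -> : 'D_v (c i) x = v 0 i by exact: derive_coord.
change (x 0 i * v 0 i + x 0 i * v 0 i = 2 * v 0 i * x 0 i); ring.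
Qed.

Lemma derive_bump_alg f (v : W) : bump_alg f -> bump_alg ('D_v f).
Proof.
move=> sf; elim: (sf) => [c|i|{}f g {}sf df sg dg|{}f g {}sf df sg dg|k].
- rewrite (_ : 'D_v _ = fun=> 0); first exact: bump_alg_cst.
  by apply/funext => x; exact: derive_cst.
- rewrite (_ : 'D_v _ = fun=> v 0 i); first exact: bump_alg_cst.
  by apply/funext => x; exact: derive_coord.
- rewrite (_ : 'D_v _ = 'D_v f + 'D_v g); first exact: bump_alg_add.
  by apply/funext => x; apply: deriveD; apply: diff_derivable; exact: differentiable_bump_alg.
- rewrite (_ : 'D_v _ = f * 'D_v g + g * 'D_v f).
    by apply: bump_alg_add; apply: bump_alg_mul.
  by apply/funext => x; apply: deriveM; apply: diff_derivable; exact: differentiable_bump_alg.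
- rewrite (_ : 'D_v _ = (flat k.+2 \o sqn + (fun=> - k%:R) * (flat k.+1 \o sqn)) * 'D_v sqn).
    apply: bump_alg_mul; last exact: derive_sqn.
    apply: bump_alg_add; first exact: bump_alg_flat.
    by apply: bump_alg_mul; [exact: bump_alg_cst|exact: bump_alg_flat].
  apply/funext => x.
  have [dk dkE] := is_derive_flat k (sqn x).
  have df : differentiable (flat k) (sqn x) by apply/derivable1_diffP.
  rewrite deriveE; last by apply: differentiable_comp => //; exact: differentiable_sqn.
  rewrite diff_comp//; last exact: differentiable_sqn.
  have E := @deriveE _ _ _ sqn x v (differentiable_sqn x).
  rewrite [LHS]/= -E.
  rewrite diff1E// derive1E dkE !fctE /= mulrC.
rewrite -[LHS]/(_ * _); ring.
Qed.

Lemma smooth_bump_alg f : bump_alg f -> smooth f.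
Proof.
move=> sf vs.
have si : bump_alg (iderive vs f) by elim: vs => //= v vs; exact: derive_bump_alg.
split=> [x|x v]; first exact/differentiable_continuous/differentiable_bump_alg.
exact/diff_derivable/differentiable_bump_alg.
Qed.

End smooth_bump.

(** * Convolution with a kernel *)

Section kernels.
Context (R : realType) (n : nat).
Local Notation mu := (@lebesgue_measure R).
Local Open Scope complex_scope.
Implicit Types (z w a b : 'rV[R[i]]_n) (x : nat -> R) (q : 'rV[R[i]]_n -> R).

Definition zeta x : 'rV[R[i]]_n := \row_j (x j +i* x (n + j)%N).

Lemma intCnE (g : 'rV[R[i]]_n -> \bar R) : intCn g = iter_int (n + n) (fun x => g (zeta x)).
Proof. by []. Qed.

Lemma supnorm0 : supnorm (0 : 'rV[R[i]]_n) = 0.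
Proof.
apply/eqP; rewrite eq_le supnorm_ge0 andbT; apply: supnorm_le => // j.
by rewrite mxE cabs0.
Qed.

Lemma supnorm_zeta_le x (K : R) : 0 <= K ->
  (forall j, (j < n + n)%N -> `|x j| <= K) -> supnorm (zeta x) <= 2 * K.
Proof.
move=> K0 xK; apply: supnorm_le => [|j]; first by rewrite mulr_ge0.
rewrite mxE (le_trans (cabs_le_ReIm _ _))//.
have := xK j (ltn_addr _ (ltn_ord j)).
have := xK (n + j)%N; rewrite ltn_add2l => /(_ (ltn_ord j)); lra.
Qed.

Lemma supnorm_zeta_ge x j : (j < n + n)%N -> `|x j| <= supnorm (zeta x).
Proof.
move=> jn; have [jn'|nj] := ltnP j n.
  by apply: le_trans (supnorm_ge _ (Ordinal jn')); rewrite mxE; exact: cabs_ge_Re.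
have jn' : (j - n < n)%N by rewrite ltn_subLR.
apply: le_trans (supnorm_ge _ (Ordinal jn')); rewrite mxE /= subnKC//.
exact: cabs_ge_Im.
Qed.

Lemma cvg_supnorm_zeta (x_ : nat -> nat -> R) x : cvg_coord x_ x ->
  supnorm (zeta (x_ k) - zeta x) @[k --> \oo] --> (0 : R).
Proof.
move=> cx; apply/cvgrPdist_lt => e e0.
have H (i : 'I_(n + n)) : \forall k \near \oo, `|x_ k i - x i| < e / 2.
  have e2 : 0 < e / 2 by rewrite divr_gt0.
  by have /cvgrPdist_lt/(_ _ e2) := cx i; apply: filterS => k; rewrite distrC.
have H' : \forall k \near \oo, forall i : 'I_(n + n), `|x_ k i - x i| < e / 2.
  by apply: filter_forall; exact: H.
apply: filterS H' => k Hk.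
rewrite sub0r normrN ger0_norm ?supnorm_ge0//.
apply: supnorm_lt => // j; rewrite !mxE.
apply: le_lt_trans (cabs_le_ReIm _ _) _.
have := Hk (lshift n j); have := Hk (rshift n j); rewrite /=; lra.
Qed.

(** The properties of [psi_delta] on which the convolution relies, phrased through [zeta] because
    [iter_int] integrates over sequences of real coordinates. *)
Definition kernel (K B : R) q := [/\
  forall (x_ : nat -> nat -> R) x, cvg_coord x_ x -> q (zeta (x_ k)) @[k --> \oo] --> q (zeta x),
  forall w, 0 <= q w <= B,
  forall x j, (j < n + n)%N -> K < `|x j| -> q (zeta x) = 0 &
  intCn (fun w => (q w)%:E) = 1%E].

(** Splits the semicontinuity of a product u q: eventually u < U by semicontinuity of u, and U q < c
    by continuity of q. It covers l = -oo, also against q = 0, where the product is 0. *)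
Lemma real_between (l : \bar R) (q c : R) : (l < +oo)%E -> 0 <= q -> (l * q%:E < c%:E)%E ->
  exists2 U : R, (l < U%:E)%E & U * q < c.
Proof.
move=> ly; rewrite le_eqVlt => /predU1P[<-|q0].
  rewrite mule0 lte_fin => c0; case: l ly => [r _| |_]//.
    by exists (r + 1); [rewrite lte_fin; lra|rewrite mulr0].
  by exists 0; [exact: ltNyr|rewrite mulr0].
case: l ly => [r _| |_]//.
  rewrite -EFinM lte_fin => h; exists (r + (c - r * q) / (2 * q)).
    by rewrite lte_fin ltrDl divr_gt0//; lra.
  have -> : (r + (c - r * q) / (2 * q)) * q = r * q + (c - r * q) / 2.
    by field; rewrite gt_eqF.
  lra.
by move=> _; exists ((c - 1) / q); [exact: ltNyr|rewrite divfK ?gt_eqF//; lra].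
Qed.

Lemma cvg_usc (u : 'rV[R[i]]_n -> \bar R) (y_ : nat -> 'rV[R[i]]_n) y (c : R) : usc u ->
  supnorm (y_ k - y) @[k --> \oo] --> (0 : R) -> (u y < c%:E)%E ->
  \forall k \near \oo, (u (y_ k) < c%:E)%E.
Proof.
move=> uu cy /uu[r r0 h].
have H : \forall k \near \oo, supnorm (y_ k - y) < r by exact: (cvgr_lt 0 cy r r0).
by apply: filterS H => k; exact: h.
Qed.

Section convolution.
Variables (K B : R) (q : 'rV[R[i]]_n -> R) (u : 'rV[R[i]]_n -> \bar R).
Hypotheses (K0 : 0 <= K) (B0 : 0 <= B) (qk : kernel K B q).
Hypotheses (uy : forall z, (u z < +oo)%E) (uu : usc u).
Hypothesis ub : forall rho : R, exists2 M : R, 0 <= M &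
  forall z, supnorm z <= rho -> (u z <= M%:E)%E.

Definition conv_integrand z x : \bar R := (u (z - zeta x) * (q (zeta x))%:E)%E.

Lemma convolE z : convol u q z = iter_int (n + n) (conv_integrand z).
Proof. by []. Qed.

Lemma usc_along_conv_integrand (z_ : nat -> 'rV[R[i]]_n) z : supnorm (z_ k - z) @[k --> \oo] --> (0 : R) ->
  usc_along (fun k => conv_integrand (z_ k)) (conv_integrand z).
Proof.
move=> cz x_ x cx c; rewrite /conv_integrand; have [qc q0B _ _] := qk.
have q0 w : 0 <= q w by have /andP[] := q0B w.
move=> /(real_between (uy _) (q0 _))[U uU Uq].
have cy : supnorm ((z_ k - zeta (x_ k)) - (z - zeta x)) @[k --> \oo] --> (0 : R).
  have h := cvg_supnorm_zeta cx.
  have h2 : supnorm (z_ k - z) + supnorm (zeta (x_ k) - zeta x) @[k --> \oo] --> (0 : R).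
    by rewrite -[X in _ --> X]addr0; exact: cvgD.
  apply: (squeeze_cvgr _ (cvg_cst 0) h2); apply: nearW => k.
  rewrite supnorm_ge0/=.
  have -> : z_ k - zeta (x_ k) - (z - zeta x) = (z_ k - z) + - (zeta (x_ k) - zeta x).
    by rewrite !opprD !opprK addrACA.
  by rewrite (le_trans (supnormD _ _))// supnormN.
have H1 := cvg_usc uu cy uU.
have H2 : \forall k \near \oo, U * q (zeta (x_ k)) < c.
  have h : U * q (zeta (x_ k)) @[k --> \oo] --> U * q (zeta x).
    by apply: cvgM; [exact: cvg_cst|exact: qc].
  exact: (cvgr_lt _ h).
apply: filterS2 H1 H2 => k h1 h2.
apply: (@le_lt_trans _ _ (U%:E * (q (zeta (x_ k)))%:E)%E).
  by apply: lee_wpmul2r; [rewrite lee_fin|exact: ltW].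
by rewrite -EFinM lte_fin.
Qed.

Lemma usc_supp_conv_integrand (rho : R) : exists2 M : R, 0 <= M &
  forall z, supnorm z <= rho -> usc_supp (n + n) K M (conv_integrand z).
Proof.
(* If all real coordinates are at most K in absolute value, [zeta x] has norm at most 2K, real and
   imaginary parts contributing K each. *)
have [M M0 HM] := ub (rho + 2 * K); have [qc q0B qs _] := qk.
exists (M * B); first exact: mulr_ge0.
move=> z zr; split.
- by apply: usc_along_conv_integrand; under eq_fun do rewrite subrr; rewrite supnorm0; exact: cvg_cst.
- move=> x; rewrite /conv_integrand.
  have [[j [jn Kj]]|H] := pselect (exists j, (j < n + n)%N /\ K < `|x j|).
    by rewrite (qs _ j)// mule0 lee_fin mulr_ge0.
  have /andP[q0 qB] := q0B (zeta x).
  apply: (@le_trans _ _ (M%:E * (q (zeta x))%:E)%E); last first.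
    by rewrite -EFinM lee_fin ler_wpM2l.
  apply: lee_wpmul2r; first by rewrite lee_fin.
  apply: HM; apply: (le_trans (supnormD _ _)); rewrite supnormN lerD//.
  apply: supnorm_zeta_le => // j jn; rewrite leNgt; apply/negP => h.
  by apply: H; exists j.
- by move=> x j jn Kx; rewrite /conv_integrand (qs _ j)// mule0.
Qed.

Lemma cvg_supnorm_bound (z_ : nat -> 'rV[R[i]]_n) z (r : R) :
  (forall k, supnorm (z_ k - z) <= r) -> forall k, supnorm (z_ k) <= supnorm z + r.
Proof.
move=> h k; rewrite -[z_ k](subrK z) addrC (le_trans (supnormD _ _))//.
by rewrite lerD2l.
Qed.

(** The radius [r] provides one upper bound for all the integrands, as reverse Fatou requires. *)
Lemma convol_usc_along (z_ : nat -> 'rV[R[i]]_n) z (r c : R) :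
  (forall k, supnorm (z_ k - z) <= r) ->
  supnorm (z_ k - z) @[k --> \oo] --> (0 : R) -> (convol u q z < c%:E)%E ->
  \forall k \near \oo, (convol u q (z_ k) < c%:E)%E.
Proof.
move=> zr cz; have [M M0 aM] := usc_supp_conv_integrand (supnorm z + r).
have r0 : 0 <= r by apply: le_trans (zr 0%N); exact: supnorm_ge0.
rewrite convolE; apply: (iter_int_usc_along K0 M0).
- by move=> k; apply: aM; exact: cvg_supnorm_bound.
- by apply: aM; rewrite lerDl.
- exact: usc_along_conv_integrand.
Qed.

Lemma convol_usc : usc (convol u q).
Proof.
move=> z c zc; apply: contrapT => H.
have {}H k : exists w, supnorm (w - z) < k.+1%:R^-1 /\ ~ (convol u q w < c%:E)%E.
  apply: contrapT => H'; apply: H; exists k.+1%:R^-1; first by rewrite invr_gt0.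
  by move=> w h1; apply: contrapT => h2; apply: H'; exists w.
have [w_ Hw] := choice H.
have cw : supnorm (w_ k - z) @[k --> \oo] --> (0 : R).
  apply/cvgrPdist_lt => d d0; near=> k.
  rewrite sub0r normrN ger0_norm ?supnorm_ge0//.
  have [h _] := Hw k; apply: (lt_trans h).
  by near: k; exact: near_infty_natSinv_lt (PosNum d0).
have w1 k : supnorm (w_ k - z) <= 1.
  by have [h _] := Hw k; apply/ltW/(lt_le_trans h); rewrite invf_le1 ?ler1n.
have [N _ /(_ N (leqnn N))] := convol_usc_along w1 cw zc.
by have [_] := Hw N.
Unshelve. all: by end_near. Qed.

Lemma convol_lty z : (convol u q z < +oo)%E.
Proof.
have [M M0 aM] := usc_supp_conv_integrand (supnorm z).
apply: (le_lt_trans (iter_int_le K0 M0 (aM z (lexx _)))); exact: ltry.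
Qed.

Lemma integralZ_usc (f : R -> \bar R) (c L M : R) : 0 <= c -> 0 <= L -> 0 <= M ->
  usc_seq1 f -> (forall t, (f t <= M%:E)%E) ->
  (\int[mu]_(t in `[0%R, L]) (c%:E * f t) = c%:E * \int[mu]_(t in `[0%R, L]) f t)%E.
Proof.
move=> c0 L0 M0 uf fM; rewrite integral_mkcond [in RHS]integral_mkcond.
pose D : set R := `[0, L]%classic.
have bf : ub_supp L M (f \_ D).
  split.
  - have mD : measurable (D : set (measurableTypeR R)) by exact: measurable_itv.
    apply/(measurable_restrictT _ mD); apply: measurable_funTS; exact: usc_seq1_measurable.
  - by move=> t; rewrite /patch; case: ifP => // _; rewrite lee_fin.
  - move=> t tp; rewrite /patch; case: ifPn => // /set_mem; rewrite /D/= in_itv/= => /andP[t0 t2].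
    by exfalso; move: tp; rewrite ger0_norm//; lra.
rewrite -integralZ_posfin//.
- by apply: eq_integral => t _; rewrite /patch; case: ifP => // _; rewrite mule0.
- by case: bf.
- exact: (integral_ub_supp_posy L0 M0 bf).
Qed.

Lemma supnorm_expi b t : supnorm (expi t *: b) <= supnorm b.
Proof.
apply: supnorm_le => [|j]; first exact: supnorm_ge0.
by rewrite mxE cabsM cabs_expi mul1r; exact: supnorm_ge.
Qed.

Lemma supnorm_circle a b t : supnorm (a + expi t *: b) <= supnorm a + supnorm b.
Proof.
by apply: (le_trans (supnormD _ _)); rewrite lerD2l supnorm_expi.
Qed.

Lemma cvg_circle a b (t_ : nat -> R) t : t_ k @[k --> \oo] --> t ->
  supnorm ((a + expi (t_ k) *: b) - (a + expi t *: b)) @[k --> \oo] --> (0 : R).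
Proof.
move=> ct.
have h : cabs (- expi t + expi (t_ k) * 1) * supnorm b @[k --> \oo] --> (0 : R).
  rewrite (_ : (0 : R) = cabs (- expi t + expi t * 1) * supnorm b); last first.
    by rewrite mulr1 addNr cabs0 mul0r.
  by apply: cvgM; [exact: cvg_cabs_circle|exact: cvg_cst].
apply: (squeeze_cvgr _ (cvg_cst 0) h); apply: nearW => k.
rewrite supnorm_ge0 andTb mulr1; apply: supnorm_le => [|j].
  by rewrite mulr_ge0 ?cabs_ge0 ?supnorm_ge0.
rewrite !mxE opprD addrACA subrr add0r -mulrBl cabsM addrC.
by rewrite ler_wpM2l ?cabs_ge0// supnorm_ge.
Qed.

(** The inequality for u at a - zeta, weighted by q >= 0, is integrated in zeta; [iter_int_fubini]
    then exchanges the circle with the coordinates. *)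
Lemma convol_submean a b :
  (forall a b, u a <= ((2 * pi)^-1)%:E * \int[mu]_(t in `[0%R, (2 * pi)%R]) u (a + expi t *: b)%R)%E ->
  (convol u q a <= ((2 * pi)^-1)%:E *
     \int[mu]_(t in `[0%R, (2 * pi)%R]) convol u q (a + expi t *: b)%R)%E.
Proof.
move=> usub; set c0 := (2 * pi)^-1.
have pi0 : 0 < 2 * pi :> R by rewrite mulr_gt0 ?pi_gt0.
have c00 : 0 <= c0 by rewrite invr_ge0 ltW.
have [qc q0B qs _] := qk.
have q0 w : 0 <= q w by have /andP[] := q0B w.
have [M M0 aM] := usc_supp_conv_integrand (supnorm a + supnorm b).
(* [iter_int_fubini] wants the parameter interval [0, 2 pi] inside the cube. *)
pose K' := Num.max K (2 * pi).
have KK' : K <= K' by rewrite le_max lexx.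
have K'0 : 0 <= K' by apply: le_trans KK'.
pose F t x := (c0%:E * conv_integrand (a + expi t *: b)%R x)%E.
have aF t : usc_supp (n + n) K M (conv_integrand (a + expi t *: b)) by apply: aM; exact: supnorm_circle.
have uscZ (f_ : nat -> (nat -> R) -> \bar R) f : usc_along f_ f ->
    (forall k x, (f_ k x < +oo)%E) -> (forall x, (f x < +oo)%E) ->
    usc_along (fun k x => c0%:E * f_ k x)%E (fun x => c0%:E * f x)%E.
  move=> uf fy_ fy x_ x cx c; rewrite muleC => /(real_between (fy _) c00)[U fU Uc].
  apply: filterS (uf _ _ cx _ fU) => k h.
  apply: (@le_lt_trans _ _ (U * c0)%:E); last by rewrite lte_fin.
  by rewrite muleC EFinM lee_wpmul2r ?lee_fin// ltW.
have cFy z x : (conv_integrand z x < +oo)%E.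
  have [M' M'0 aM'] := usc_supp_conv_integrand (supnorm z); have [_ h _] := aM' z (lexx _).
  by apply: (le_lt_trans (h x)); exact: ltry.
have aF' t : usc_supp (n + n) K' (c0 * M) (F t).
  apply: (usc_supp_weak KK' (lexx _)); have [uf fM f0] := aF t; split.
  - exact: uscZ.
  - by move=> x; rewrite EFinM lee_wpmul2l ?lee_fin.
  - by move=> x j jn Kx; rewrite /F (f0 _ j)// mule0.
have uF (t_ : nat -> R) t : t_ k @[k --> \oo] --> t -> usc_along (fun k => F (t_ k)) (F t).
  by move=> ct; apply: uscZ => //; apply: usc_along_conv_integrand; exact: cvg_circle.
have usct : usc_seq1 (fun t => convol u q (a + expi t *: b)).
  move=> t_ t ct c; apply: (@convol_usc_along _ _ (2 * supnorm b)) => [k|]; last exact: cvg_circle.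
  rewrite opprD addrACA subrr add0r (le_trans (supnormD _ _))// supnormN.
  have := supnorm_expi b (t_ k); have := supnorm_expi b t; lra.
apply: (@le_trans _ _ (iter_int (n + n) (fun x => \int[mu]_(t in `[0%R, (2 * pi)%R]) F t x))%E).
  rewrite convolE; apply: iter_int_mono => x.
  rewrite /F /conv_integrand.
  have [M' M'0 HM'] := ub (supnorm (a - zeta x) + supnorm b).
  have addE t : a + expi t *: b - zeta x = (a - zeta x) + expi t *: b by rewrite addrAC.
  set Q := q (zeta x).
  have -> : (\int[mu]_(t in `[0%R, (2 * pi)%R]) (c0%:E * (u (a + expi t *: b - zeta x)%R * Q%:E)) =
      \int[mu]_(t in `[0%R, (2 * pi)%R]) ((Q * c0)%:E * u (a - zeta x + expi t *: b)%R))%E.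
    by apply: eq_integral => t _; rewrite addE (muleC (u _)) muleA -EFinM (mulrC c0).
  rewrite (integralZ_usc _ (ltW pi0) M'0); first last.
  - by move=> t; apply: HM'; exact: supnorm_circle.
  - move=> t_ t ct c; apply: cvg_usc => //; exact: cvg_circle.
  - by rewrite mulr_ge0// /Q.
  by rewrite muleC EFinM -muleA lee_wpmul2l ?lee_fin// /Q.
rewrite -(iter_int_fubini K'0 (mulr_ge0 c00 M0) _ aF' uF); last by rewrite le_max lexx orbT.
have N0 : (0 <= M * (2 * K) ^+ (n + n)) by rewrite mulr_ge0// exprn_ge0// mulr_ge0.
rewrite -(integralZ_usc c00 (ltW pi0) N0)//; last first.
  by move=> t; rewrite convolE; exact: iter_int_le.
by apply: integral_mono => t _; rewrite /F (iter_intZ K0 M0 c00 (aF t)).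
Qed.

End convolution.
End kernels.

(** * Mollification *)

Section admissible_extra.
Context (R : realType).
Local Notation mu := (@lebesgue_measure R).
Implicit Types (x : nat -> R) (K B M : R).

Lemma usc_supp_EFin m K B (f : (nat -> R) -> R) :
  (forall (x_ : nat -> nat -> R) x, cvg_coord x_ x -> f (x_ k) @[k --> \oo] --> f x) ->
  (forall x, f x <= B) ->
  (forall x j, (j < m)%N -> K < `|x j| -> f x = 0) -> usc_supp m K B (fun x => (f x)%:E).
Proof.
move=> fc fB f0; split=> [x_ x /fc cx c|x|x j jm Kx]; rewrite ?lte_fin ?lee_fin//.
  move=> fxc; have H : \forall k \near \oo, f (x_ k) < c by exact: (cvgr_lt _ cx).
  by apply: filterS H => k; rewrite lte_fin.
by rewrite (f0 _ j).
Qed.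

Lemma iter_int_scale m K M (d : R) (g : (nat -> R) -> \bar R) :
  0 <= K -> 0 <= M -> 0 < d -> usc_supp m K M g -> (forall x, (0 <= g x)%E) ->
  (iter_int m (fun x => g (fun k => x k / d)%R) = (d ^+ m)%:E * iter_int m g)%E.
Proof.
move=> K0 M0 d0; elim: m g => [|m IH] g ag g0 /=.
  by rewrite expr0 mul1e; congr g; apply/funext => k; rewrite mul0r.
have bg := iter_int_ub_supp K0 M0 ag.
have Mm0 : 0 <= M * (2 * K) ^+ m by rewrite mulr_ge0// exprn_ge0// mulr_ge0.
pose H t := ((d ^+ m)%:E * iter_int m (fun x => g (upd x m t)))%E.
have d00 : 0 <= d ^+ m by rewrite exprn_ge0// ltW.
transitivity (\int[mu]_t H (t / d)%R)%E.
  apply: eq_integral => t _; rewrite /H -IH//; last exact: usc_supp_slice.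
  congr iter_int; apply/funext => x; congr g; apply/funext => k; rewrite /upd.
  by case: ifP.
have mG : measurable_fun setT (fun t => iter_int m (fun x => g (upd x m t))) by case: bg.
rewrite integral_scale//; last 2 first.
- exact: measurable_funeM.
- move=> t; rewrite /H mule_ge0 ?lee_fin// -(iter_int0 R m); exact: iter_int_mono.
rewrite /H integralZ_posfin//; last exact: (integral_ub_supp_posy K0 Mm0 bg).
by rewrite muleA -EFinM -exprS.
Qed.

End admissible_extra.

(** * The class L^S under convolution with a kernel *)

Section convolution_growth.
Context (R : realType) (n : nat).
Local Open Scope complex_scope.
Implicit Types (z w : 'rV[R[i]]_n) (q : 'rV[R[i]]_n -> R) (u : 'rV[R[i]]_n -> \bar R).
Variable S : set 'rV[R]_n.
Hypotheses (cS : compact S) (SR : S `<=` @Rnplus R n) (S0 : S 0).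

Lemma LS_bounded u : (forall xi, phiS S xi = phiS S (posp xi)) -> LS S u ->
  forall rho : R, exists2 M : R, 0 <= M & forall z, supnorm z <= rho -> (u z <= M%:E)%E.
Proof.
move=> H [_ [c uc]] rho.
set sg := phiS S (onesv R n); have sg0 : 0 <= sg by exact: phiS_ge0.
have p0 : 0 <= phiS S (logp 0) by exact: phiS_ge0.
exists (`|c| + sg * `|rho| + phiS S (logp 0)); first by rewrite !addr_ge0// mulr_ge0.
move=> z zr; apply: (le_trans (uc z)); rewrite (HSE cS SR S0 z H) -EFinD lee_fin.
have := phiS_logp_lip cS SR S0 0 z; rewrite subr0 -/sg.
have := ler_norm c; have := ler_norm rho; have := supnorm_ge0 z; nra.
Qed.

Lemma usc_supp_kernel K B q : kernel K B q -> usc_supp (n + n) K B (fun x => (q (zeta n x))%:E).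
Proof.
move=> [qc q0B qs _]; apply: usc_supp_EFin => //.
- by move=> x; have /andP[] := q0B (zeta n x).
Qed.

Lemma convol_LS K B q u : 0 <= K -> 0 <= B -> kernel K B q ->
  (forall xi, phiS S xi = phiS S (posp xi)) -> LS S u -> LS S (convol u q).
Proof.
move=> K0 B0 qk H uLS; have ub := LS_bounded H uLS.
have [[uy uu usub] [c uc]] := uLS.
split.
  split.
  - exact: (convol_lty K0 B0 qk).
  - exact: (convol_usc K0 B0 qk).
  - by move=> a b; exact: (convol_submean K0 B0 qk).
set sg := phiS S (onesv R n); have sg0 : 0 <= sg by exact: phiS_ge0.
(* On the support of q, (iv) adds at most sigma_S times 2K, and q has mass 1. The absolute value
   keeps [C] nonnegative, as [iter_intZ] asks. *)
exists (`|c| + sg * (2 * K)) => z.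
have HH := HSE cS SR S0 z H; set h := phiS S (logp z) in HH.
have h0 : 0 <= h by exact: phiS_ge0.
rewrite HH -EFinD; set C := _ + h.
have C0 : 0 <= C by rewrite /C !addr_ge0// !mulr_ge0.
have [qc q0B qs qi] := qk.
apply: (@le_trans _ _ (iter_int (n + n) (fun x => C%:E * (q (zeta n x))%:E))%E); last first.
  rewrite (iter_intZ K0 B0 C0 (usc_supp_kernel qk)).
  by move: qi; rewrite intCnE => ->; rewrite mule1.
rewrite convolE; apply: iter_int_mono => x; rewrite /conv_integrand.
have [[j [jn Kj]]|nK] := pselect (exists j, (j < n + n)%N /\ K < `|x j|).
  by rewrite (qs _ j)// !mule0.
have /andP[q0 qB] := q0B (zeta n x).
apply: lee_wpmul2r; first by rewrite lee_fin.
apply: (le_trans (uc _)).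
have := HS_translate cS SR S0 H z (zeta n x); rewrite HH -EFinD -/sg => hh.
apply: (le_trans (leeD (lexx _) hh)); rewrite -EFinD lee_fin /C.
have := ler_norm c.
have : supnorm (zeta n x) <= 2 * K.
  apply: supnorm_zeta_le => // j jn; rewrite leNgt; apply/negP => h'.
  by apply: nK; exists j.
nra.
Qed.

End convolution_growth.

(** * Rescaled mollifiers as kernels, and the existence of a mollifier *)

Section mollifiers.
Context (R : realType) (n : nat).
Local Open Scope complex_scope.
Implicit Types (psi : 'rV[R[i]]_n -> R).

Definition rvec (x : nat -> R) : 'rV[R]_(n + n) := \row_i x i.

Lemma realif_rvec (x : nat -> R) : realif (rvec x) = zeta n x.
Proof. by apply/rowP => j; rewrite !mxE. Qed.

Lemma cvg_rvec (x_ : nat -> nat -> R) x : cvg_coord x_ x ->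
  rvec (x_ k) @[k --> \oo] --> rvec x.
Proof.
move=> cx; apply/cvg_ballP => e e0.
have H : \forall k \near \oo, forall i : 'I_(n + n), `|x i - x_ k i| < e.
  by apply: filter_forall => i; have /cvgrPdist_lt := cx i; exact.
apply: filterS H => k Hk; split => // i j; rewrite !mxE; exact: Hk.
Qed.

Lemma smooth_cvg psi (x_ : nat -> nat -> R) x : smooth (psi \o @realif R n) ->
  cvg_coord x_ x -> psi (zeta n (x_ k)) @[k --> \oo] --> psi (zeta n x).
Proof.
move=> /(_ [::])[/= pc _] cx.
have E : (psi \o @realif R n) \o (fun k => rvec (x_ k)) = fun k => psi (zeta n (x_ k)).
  by apply/funext => k; rewrite /= realif_rvec.
by rewrite -E -realif_rvec; exact: (cvg_comp _ _ (cvg_rvec cx) (pc (rvec x))).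
Qed.

Definition coords (w : 'rV[R[i]]_n) : 'rV[R]_(n + n) :=
  row_mx (\row_j complex.Re (w 0 j)) (\row_j complex.Im (w 0 j)).

Lemma coordsK w : realif (coords w) = w.
Proof.
apply/rowP => j; rewrite mxE /coords row_mxEl row_mxEr !mxE.
by case: (w 0 j).
Qed.

Lemma mollifier_bounded psi : mollifier psi -> exists2 B, 0 <= B & forall w, psi w <= B.
Proof.
move=> [ps [M pM] _ p0 _].
pose K := Num.max M 0.
have K0 : 0 <= K by rewrite le_max lexx orbT.
pose A : set 'rV[R]_(n + n) := [set v | forall i, `[- K, K]%classic (v ord0 i)].
have cA : compact A by apply: (@rV_compact _ _ (fun=> `[- K, K]%classic)) => i; exact: segment_compact.
have A0 : A !=set0.
  by exists 0 => i; rewrite /= in_itv/= mxE oppr_le0 K0.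
have [pc _] := ps [::].
have [v _ vmax] := EVT_max_rV A0 cA (continuous_subspaceT pc).
exists (psi (realif v)) => // w.
have [wK|Kw] := leP (supnorm w) K; last first.
  by rewrite pM//; apply: le_lt_trans Kw; rewrite le_max lexx.
have := vmax (coords w); rewrite /= coordsK; apply; rewrite inE => i /=.
rewrite in_itv/= -ler_norml; apply: le_trans wK; rewrite /coords mxE.
by case: split_ordP => j _; rewrite mxE; apply: le_trans (supnorm_ge _ j);
   case: (w 0 j) => ? ?; [exact: cabs_ge_Re|exact: cabs_ge_Im].
Qed.

Lemma kernel_psi_delta psi (d : R) : mollifier psi -> 0 < d ->
  exists K B, [/\ 1 <= K, 0 <= B & kernel K B (psi_delta psi d)].
Proof.
move=> pm d0; have [B B0 pB] := mollifier_bounded pm.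
have [ps [M pM] _ p0 pi1] := pm.
pose dn := d ^- (2 * n).
have dn0 : 0 < dn by rewrite invr_gt0 exprn_gt0.
(* K >= 1 leaves room in the cube for the slabs of half width e <= 1 used in [mollify_phiS]. *)
pose K := Num.max (Num.max M 0 * d) 1.
have K1 : 1 <= K by rewrite le_max lexx orbT.
have scz x : (d^-1)%:C *: zeta n x = zeta n (fun k => x k / d).
  apply/rowP => j; rewrite !mxE; apply/eqP; rewrite eq_complex /= !mul0r subr0 addr0.
  by rewrite mulrC eqxx mulrC eqxx.
have M'0 : 0 <= Num.max M 0 by rewrite le_max lexx orbT.
have supp x j : (j < n + n)%N -> Num.max M 0 < `|x j| -> psi (zeta n x) = 0.
  move=> jn Kx; apply: pM; apply: le_lt_trans (lt_le_trans Kx (supnorm_zeta_ge _ jn)).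
  by rewrite le_max lexx.
have apsi : usc_supp (n + n) (Num.max M 0) B (fun x => (psi (zeta n x))%:E).
  by apply: usc_supp_EFin => // x_ x; exact: smooth_cvg.
have adpsi : usc_supp (n + n) (Num.max M 0) (dn * B) (fun x => (dn * psi (zeta n x))%:E).
  apply: usc_supp_EFin => [x_ x cx|x|x j jn Kx].
  - by apply: cvgM; [exact: cvg_cst|exact: smooth_cvg].
  - by rewrite ler_wpM2l// ltW.
  - by rewrite (supp _ j)// mulr0.
have dnB : 0 <= dn * B by rewrite mulr_ge0// ltW.
exists K, (dn * B); split => //; split.
- move=> x_ x cx; rewrite /psi_delta scz; under eq_fun do rewrite scz.
  apply: cvgM; first exact: cvg_cst.
  by apply: smooth_cvg => // j; apply: cvgM; [exact: cx|exact: cvg_cst].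
- by move=> w; rewrite /psi_delta mulr_ge0 ?(ltW dn0)//= ler_wpM2l// ltW.
- move=> x j jn Kx; rewrite /psi_delta scz (supp _ j) ?mulr0//.
  rewrite normrM normfV (gtr0_norm d0) ltr_pdivlMr//.
  by apply: le_lt_trans Kx; rewrite /K le_max lexx.
- rewrite intCnE.
  transitivity (iter_int (n + n) (fun x => (dn * psi (zeta n (fun k => x k / d)))%:E)).
    by congr iter_int; apply/funext => x; rewrite /psi_delta scz.
  rewrite (iter_int_scale M'0 dnB d0 adpsi); last first.
    by move=> x; rewrite lee_fin mulr_ge0// ltW.
  under [X in (_ * iter_int _ X)%E]eq_fun do rewrite EFinM.
  rewrite (iter_intZ M'0 B0 (ltW dn0) apsi).
  move: pi1; rewrite intCnE => ->; rewrite mule1 -EFinM /dn addnn -mul2n divff//.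
  by rewrite expf_neq0// gt_eqF.
Qed.

(** The standard bump exp(-1 / (1 - |w|^2)) on the open unit ball, 0 outside. *)
Definition bump (w : 'rV[R[i]]_n) : R := flat 0 (1 - \sum_(j < n) cabs (w 0 j) ^+ 2).

Lemma bump_realif (x : 'rV[R]_(n + n)) : bump (realif x) = flat 0 (sqn x).
Proof.
rewrite /bump /sqn big_split_ord/= -big_split/=; congr (flat 0 (1 - _)).
by apply: eq_bigr => j _; rewrite mxE cabs_sq -!expr2.
Qed.

Lemma bump_supp w : 1 < supnorm w -> bump w = 0.
Proof.
move=> w1; apply: flat_le0; rewrite subr_le0 leNgt; apply/negP => h.
move: w1; rewrite ltNge => /negP; apply; apply: supnorm_le => // j.
rewrite leNgt; apply/negP => wj; move: h; rewrite ltNge => /negP; apply.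
rewrite (bigD1 j)//= -[leLHS]addr0 lerD//; last by apply: sumr_ge0 => i _; exact: sqr_ge0.
by rewrite -[leLHS](expr1n _ 2) lerXn2r ?nnegrE ?cabs_ge0// ltW.
Qed.

Lemma mollifier_exists : exists psi, mollifier psi.
Proof.
have bump_alg_bump c : bump_alg ((fun=> c) * (bump \o @realif R n)).
  apply: bump_alg_mul; first exact: bump_alg_cst.
  by rewrite (_ : bump \o _ = flat 0 \o @sqn R (n + n)); [exact: bump_alg_flat|apply/funext => x; exact: bump_realif].
have sm c : smooth ((fun w => c * bump w) \o @realif R n).
  by apply: smooth_bump_alg; exact: bump_alg_bump.
have b1 w : bump w <= 1 by exact: flat0_le1.
have b0 w : 0 <= bump w by exact: flat_ge0.
have supp x j : (j < n + n)%N -> 1 < `|x j| -> bump (zeta n x) = 0.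
  by move=> jn Kx; apply: bump_supp; apply: lt_le_trans Kx (supnorm_zeta_ge _ jn).
have ab : usc_supp (n + n) 1 1 (fun x => (bump (zeta n x))%:E).
  apply: usc_supp_EFin => // x_ x cx.
  have := smooth_cvg (sm 1) cx; rewrite mul1r; under eq_fun do rewrite mul1r; exact.
pose I := iter_int (n + n) (fun x => (bump (zeta n x))%:E).
have Iy : (I < +oo)%E by apply: (le_lt_trans (iter_int_le ler01 ler01 ab)); exact: ltry.
pose N : R := (n + n)%:R.
have N0 : 0 <= N by rewrite ler0n.
(* On the cube of half side r one has |x|^2 <= N r^2 <= 1/2, so the bump is at least exp(-2) there
   and its integral is positive. *)
pose r := (2 * N + 2)^-1.
have r0 : 0 < r by rewrite invr_gt0; lra.
have rN : r * (2 * N + 2) = 1 by rewrite mulVf// gt_eqF//; lra.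
have I0 : (0 < I)%E.
  apply: (@lt_le_trans _ _ (expR (- 2) * \prod_(k < n + n) (r - (- r)))%:E).
    rewrite lte_fin mulr_gt0 ?expR_gt0//; apply: prodr_gt0 => k _; lra.
  rewrite -(@iter_int_box _ _ (fun=> - r) (fun=> r)); last 2 first.
  - exact: expR_ge0.
  - by move=> k _; lra.
  apply: iter_int_mono => x; rewrite lee_fin.
  have [xr|/existsNP[j xj]] := pselect (forall k : 'I_(n + n), `[- r, r]%classic (x k)); last first.
    by rewrite (bigD1 j)//= indicE memNset// mul0r mulr0.
  rewrite big1 ?mulr1; last by move=> k _; rewrite indicE mem_set.
  have q2 : 2^-1 <= sqn (rvec x).
    rewrite /sqn; have : \sum_(i < n + n) rvec x 0 i * rvec x 0 i <= \sum_(i < n + n) r ^+ 2.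
      apply: ler_sum => i _; rewrite mxE -expr2.
      have := xr i; rewrite /= in_itv/= -ler_norml => h.
      by rewrite -(real_normK (num_real _)) lerXn2r ?nnegrE// ltW.
    rewrite sumr_const card_ord -[r ^+ 2 *+ _]mulr_natr -/N expr2.
    have : r <= 2^-1 by rewrite /r lef_pV2 ?posrE; lra.
    nra.
  rewrite -realif_rvec bump_realif /flat ifT; last by apply: lt_le_trans q2; rewrite invr_gt0.
  rewrite expr0 mulr1 ler_expR lerN2 -[leRHS]invrK lef_pV2 ?posrE//.
  by apply: lt_le_trans q2; rewrite invr_gt0.
have [c c0 IE] : exists2 c : R, 0 < c & I = c%:E.
  by case: I I0 Iy => [c c0 _| |]//; exists c.
exists (fun w => c^-1 * bump w); split => //.
- by exists 1 => w /bump_supp ->; rewrite mulr0.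
- move=> w w' ww; rewrite /bump; congr (_ * flat 0 (1 - _)).
  have sq (y : 'rV[R[i]]_n) : \sum_(j < n) cabs (y 0 j) ^+ 2 = eucnorm y ^+ 2.
    by rewrite sqr_sqrtr//; apply: sumr_ge0 => j _; exact: sqr_ge0.
  by rewrite !sq ww.
- by move=> w; rewrite mulr_ge0// invr_ge0 ltW.
- rewrite intCnE.
  under [X in iter_int _ X]eq_fun do rewrite EFinM.
  rewrite (iter_intZ ler01 ler01 _ ab) ?invr_ge0 ?ltW//.
  by rewrite -/I IE -EFinM mulVf// gt_eqF.
Qed.

End mollifiers.

(** * From stability under mollification back to (iii) *)

Section mollification_to_phiS.
Context (R : realType) (n : nat).
Local Open Scope complex_scope.
Variable S : set 'rV[R]_n.
Hypotheses (cS : compact S) (SR : S `<=` @Rnplus R n) (S0 : S 0).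

(** The indicator of the part of the cube where |Re zeta_j| <= e, kept as a product so that
    [iter_int_box] evaluates its integral. *)
Definition slab (K e : R) (j : 'I_n) (x : nat -> R) : R :=
  \prod_(k < n + n) \1_(`[- (if k == j :> nat then e else K), if k == j :> nat then e else K]) (x k).

Lemma slab_ge0 K e (j : 'I_n) (x : nat -> R) : 0 <= slab K e j x.
Proof. by apply: prodr_ge0. Qed.

Lemma slab1 K e (j : 'I_n) (x : nat -> R) : (forall k, (k < n + n)%N -> `|x k| <= K) -> `|x j| <= e ->
  slab K e j x = 1.
Proof.
move=> xK xj; rewrite /slab big1// => k _; rewrite indicE mem_set//= in_itv/= -ler_norml.
by case: eqP => [->|_]//; exact: xK.
Qed.

Lemma slab_usc_supp K e (j : 'I_n) (C : R) : 0 <= C -> e <= K ->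
  usc_supp (n + n) K C (fun x => (C * slab K e j x)%:E).
Proof.
move=> C0 eK; split.
- exact: (@usc_along_box R (n + n) (fun k => - (if k == j :> nat then e else K))
    (fun k => if k == j :> nat then e else K)).
- move=> x; rewrite lee_fin -[leRHS]mulr1 ler_wpM2l// /slab.
  by apply: prodr_ile1 => k; rewrite indicE; case: (_ \in _); rewrite ?ler01 ?lexx.
- move=> x k kn Kx; rewrite /slab (bigD1 (Ordinal kn))//= indicE memNset ?mul0r ?mulr0//=.
  rewrite in_itv/= -ler_norml; apply/negP; rewrite -ltNge; case: ifP => // _.
  exact: le_lt_trans Kx.
Qed.

(** [W] is chosen before [e]: the integral is linear in the width, hence small for thin slabs. *)
Lemma iter_int_slab K (j : 'I_n) : 1 <= K -> exists2 W : R, 0 <= W & forall e C, 0 <= e -> 0 <= C ->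
  iter_int (n + n) (fun x => (C * slab K e j x)%:E) = (C * (e * W))%:E.
Proof.
move=> K1; have jn : (j < n + n)%N by rewrite ltn_addr.
exists (2 * \prod_(k < n + n | k != Ordinal jn) (K - - K)).
  by rewrite mulr_ge0//; apply: prodr_ge0 => k _; lra.
move=> e C e0 C0.
rewrite (@iter_int_box R (n + n) (fun k => - (if k == j :> nat then e else K))
    (fun k => if k == j :> nat then e else K))//; last first.
  by move=> k _; case: ifP => _; lra.
congr (_ * _)%:E; rewrite (bigD1 (Ordinal jn))//= eqxx.
have -> : e - - e = e * 2 by ring.
rewrite -mulrA; congr (e * (2 * _)); apply: eq_bigr => k kj.
by rewrite ifF//; apply/negbTE.
Qed.

(** Let c = |z_j - zeta_j| and L = 1 + (2K + 1)/e. As z_j is imaginary, c > e; also exp(t xi_j) <= c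
    + 2K. Since c L >= c + 2K + 1, both exp(t xi_j) and 1 are at most c L. *)
Lemma logmono_lower (s xi : 'rV[R]_n) (K e t : R) (x : nat -> R) : Rnplus s ->
  1 <= K -> 0 < e -> (forall k, (k < n + n)%N -> `|x k| <= K) -> (forall j : 'I_n, e < `|x j|) ->
  \sum_(j < n) s 0 j * (Num.max (t * xi 0 j) 0 - ln (1 + (2 * K + 1) / e)) <=
  logmono s (\row_j (0 +i* expR (t * xi 0 j)) - zeta n x).
Proof.
move=> s0 K1 e0 xK ex; set z := \row_j _; set L := 1 + _.
have Le : L * e = e + (2 * K + 1) by rewrite /L mulrDl mul1r divfK// gt_eqF.
have L0 : 0 < L by rewrite /L ltr_pwDl// divr_ge0//; lra.
have zj j : e < cabs ((z - zeta n x) 0 j).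
  rewrite !mxE /=; apply: lt_le_trans (ex j) _.
  by have := cabs_ge_Re (0 - x j) (expR (t * xi 0 j) - x (n + j)%N); rewrite {1}sub0r normrN.
have zx j : expR (t * xi 0 j) <= cabs ((z - zeta n x) 0 j) + 2 * K.
  have -> : expR (t * xi 0 j) = cabs (z 0 j).
    by rewrite mxE /cabs /= expr0n add0r sqrtr_sqr ger0_norm// expR_ge0.
  have -> : z 0 j = (z - zeta n x) 0 j + zeta n x 0 j by rewrite !mxE subrK.
  apply: (le_trans (cabsD _ _)); rewrite lerD2l.
  apply: le_trans (supnorm_ge _ j) _; apply: supnorm_zeta_le => //; lra.
apply: le_trans (logmono_ge _); last first.
  by move=> j _; rewrite -cabs_gt0; apply: lt_trans (zj j).
apply: ler_sum => j _; rewrite ler_wpM2l// lerBlDr.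
have := zj j; have := zx j; set c := cabs _ => cE ce.
have c0 : 0 < c by apply: lt_trans ce.
rewrite -lnM ?posrE//.
have h1 : expR (t * xi 0 j) <= c * L by nra.
have h2 : 1 <= c * L by nra.
rewrite ge_max; apply/andP; split; last exact: ln_ge0.
by rewrite -[leLHS]expRK ler_ln ?posrE ?expR_gt0// mulr_gt0.
Qed.

Lemma mollify_phiS :
  (forall u, LS S u -> forall psi, mollifier psi -> forall delta : R, 0 < delta ->
     LS S (convol u (psi_delta psi delta))) ->
  forall xi, phiS S xi = phiS S (posp xi).
Proof.
move=> H xi; apply/eqP; rewrite eq_le phiS_mono/=; [|exact: cS|exact: SR|by []|exact: le_posp].
have [s [Ss -> _]] := phiSP (posp xi) cS (ex_intro _ _ S0).
have [psi pm] := mollifier_exists R n.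
have [_ [c hc]] := H _ (logmono_LS cS SR S0 Ss) _ pm 1 ltr01.
have [K [B [K1 B0 qk]]] := kernel_psi_delta pm ltr01.
move: hc; set q := psi_delta psi 1 in qk * => hc.
have K0 : 0 <= K by lra.
have s0 := SR Ss.
have uc : usc (fun z => (logmono s z)%:E) by have [[_ + _] _] := logmono_LS cS SR S0 Ss.
have ub (rho : R) : exists2 M : R, 0 <= M &
    forall z : 'rV[R[i]]_n, supnorm z <= rho -> ((logmono s z)%:E <= M%:E)%E.
  exists (\sum_(j < n) s 0 j * `|rho|); first by apply: sumr_ge0 => j _; rewrite mulr_ge0.
  move=> z zr; rewrite lee_fin; apply: (le_trans (logmono_le _ s0)).
  apply: ler_sum => j _; rewrite ler_wpM2l// (le_trans (supnorm_ge _ j))//.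
  exact: le_trans zr (ler_norm _).
have HW0 (j : 'I_n) : exists w : R, 0 <= w /\ forall e C, 0 <= e -> 0 <= C ->
    iter_int (n + n) (fun x => (C * slab K e j x)%:E) = (C * (e * w))%:E.
  by have [w] := iter_int_slab j K1; exists w.
have [W HW] := choice HW0.
pose kappa := B * \sum_(j < n) W j.
have kappa0 : 0 <= kappa.
  by rewrite mulr_ge0//; apply: sumr_ge0 => j _; have [] := HW j.
set A := inner s (posp xi); set phi := phiS S xi.
have phi0 : 0 <= phi by exact: phiS_ge0.
pose D e := \sum_(j < n) s 0 j * ln (1 + (2 * K + 1) / e).
have D0 e : 0 < e -> 0 <= D e.
  move=> e0; apply: sumr_ge0 => j _; rewrite mulr_ge0// ln_ge0// lerDl divr_ge0 ?(ltW e0)//.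
  lra.
(* T = t A - D e bounds log^+ |z^s| from below off the slabs; [e * kappa] bounds the mass that the
   kernel loses on them. *)
have key e t : 0 < e -> e <= 1 -> 0 < t -> 0 <= t * A - D e ->
    (t * A - D e) * (1 - e * kappa) <= c + t * phi.
  move=> e0 e1 t0; set T := t * A - D e => T0.
  pose z : 'rV[R[i]]_n := \row_j (0 +i* expR (t * xi 0 j)).
  have cz j : cabs (z 0 j) = expR (t * xi 0 j).
    by rewrite mxE /cabs /= expr0n add0r sqrtr_sqr ger0_norm// expR_ge0.
  have Cz : Cstar z by move=> j; rewrite -cabs_gt0 cz expR_gt0.
  have lz : logabs z = t *: xi by apply/rowP => j; rewrite [LHS]mxE cz expRK mxE.
  have hz : (convol (fun z => (logmono s z)%:E) q z <= (c + t * phi)%:E)%E.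
    apply: (le_trans (hc z)); rewrite /HS; case: asboolP => // _.
    by rewrite lz -EFinD lee_fin lerD2l; exact: (phiSZ cS S0 xi (ltW t0)).
  have [M M0 aM] : exists2 M : R, 0 <= M & forall w, supnorm w <= supnorm z ->
      usc_supp (n + n) K M (conv_integrand q (fun z => (logmono s z)%:E) w).
    by apply: (@usc_supp_conv_integrand R n K B) => // w; exact: ltry.
  have {}aM := aM z (lexx _).
  have TB0 : 0 <= T * B by rewrite mulr_ge0.
  have [Is Ia] := @iter_int_sum R (n + n) n K (fun=> T * B)
    (fun j x => (T * B * slab K e j x)%:E) K0 (fun=> TB0)
    (fun j => slab_usc_supp j TB0 (le_trans e1 K1)).
  have [qc q0B qs qi] := qk.
  (* On a slab T q <= T B is paid by the slab term, the integrand being nonnegative; elsewhere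
     [logmono_lower] gives the bound. *)
  have pw x : (T%:E * (q (zeta n x))%:E <= conv_integrand q (fun z => (logmono s z)%:E) z x +
      \sum_(j < n) (T * B * slab K e j x)%:E)%E.
    rewrite /conv_integrand sumEFin -!EFinM -EFinD lee_fin.
    have sl0 (P : pred 'I_n) : 0 <= \sum_(j < n | P j) T * B * slab K e j x.
      by apply: sumr_ge0 => j _; rewrite mulr_ge0// slab_ge0.
    have [[k [kn Kk]]|nK] := pselect (exists k, (k < n + n)%N /\ K < `|x k|).
      by rewrite (qs _ k)// !mulr0 add0r.
    have xK k : (k < n + n)%N -> `|x k| <= K.
      by move=> kn; rewrite leNgt; apply/negP => h; apply: nK; exists k.
    have /andP[q0 qB] := q0B (zeta n x).
    have [[j xj]|ne] := pselect (exists j : 'I_n, `|x j| <= e).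
      rewrite (bigD1 j)//= (slab1 xK xj) mulr1.
      apply: (@le_trans _ _ (T * B)); first by rewrite ler_wpM2l.
      rewrite addrCA lerDl addr_ge0// ?sl0// mulr_ge0// logmono_ge0//.
    have ex (j : 'I_n) : e < `|x j|.
      by rewrite ltNge; apply/negP => h; apply: ne; exists j.
    apply: (@le_trans _ _ (logmono s (z - zeta n x) * q (zeta n x))); last by rewrite lerDl sl0.
    rewrite ler_wpM2r//; apply: le_trans (logmono_lower xi t s0 K1 e0 xK ex).
    rewrite /T /A /D /inner mulr_sumr -sumrB le_eqVlt; apply/orP; left; apply/eqP.
    apply: eq_bigr => j _; rewrite mxE mulrBr; congr (_ - _).
    by rewrite mulrCA maxr_pMr ?mulr0// ltW.
  have := iter_int_mono (n + n) pw.
  rewrite (iter_intZ K0 B0 T0 (usc_supp_kernel qk)).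
  move: qi; rewrite intCnE => ->; rewrite mule1.
  rewrite (iter_intD K0 M0 _ aM Ia); last by apply: sumr_ge0.
  rewrite Is -convolE => hT.
  have := le_trans hT (leeD hz (lexx _)).
  under eq_bigr => j _ do rewrite (proj2 (HW j) e (T * B) (ltW e0) TB0).
  rewrite sumEFin -EFinD lee_fin.
  have -> : \sum_(j < n) T * B * (e * W j) = T * (e * kappa).
    rewrite /kappa !mulr_sumr; apply: eq_bigr => j _; ring.
  lra.
rewrite leNgt; apply/negP => phiA.
have A0 : 0 < A by lra.
(* The slab loss A e kappa is then at most half of the gap A - phi, and phi >= 0 gives e <= 1. *)
pose e := (A - phi) / (2 * A * (kappa + 1)).
have den0 : 0 < 2 * A * (kappa + 1) by rewrite !mulr_gt0//; lra.
have e0 : 0 < e by rewrite divr_gt0//; lra.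
have eE : e * (2 * A * (kappa + 1)) = A - phi by rewrite divfK// gt_eqF.
have e1 : e <= 1 by rewrite ler_pdivrMr//; nra.
(* With e fixed, the remaining half of the gap times t equals |c| + D e + 1, which exceeds c + D
   e. *)
pose t := 2 * (`|c| + D e + 1) / (A - phi).
have De := D0 e e0.
have c0 := normr_ge0 c.
have t0 : 0 < t by rewrite divr_gt0//; lra.
have tE : t * (A - phi) = 2 * (`|c| + D e + 1) by rewrite divfK// gt_eqF//; lra.
have T0 : 0 <= t * A - D e by nra.
have := key e t e0 e1 t0 T0.
have cc := ler_norm c.
have ek0 : 0 <= e * kappa by rewrite mulr_ge0// ltW.
have h1 : 0 <= D e * (e * kappa) by rewrite mulr_ge0.
have h2 : t * (A * (e * kappa)) <= t * ((A - phi) / 2).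
  by rewrite ler_pM2l// -eE; nra.
have -> : (t * A - D e) * (1 - e * kappa) =
  t * (A - phi) + t * phi - D e - t * (A * (e * kappa)) + D e * (e * kappa) by ring.
have : t * ((A - phi) / 2) = `|c| + D e + 1.
  by rewrite mulrA tE; field.
lra.
Qed.

End mollification_to_phiS.

Unset Implicit Arguments.

Theorem theorem5p8 (R : realType) (n : nat) (S : set 'rV[R]_n) :
  compact S -> convex_set S -> S `<=` @Rnplus R n -> S 0 ->
  [<-> lower_set S;
       S = hatS S;
       forall xi : 'rV[R]_n, phiS S xi = phiS S (posp xi);
       forall z w : 'rV[R[i]]_n,
         (HS S (z - w) <= (phiS S (onesv R n) * supnorm w)%:E + HS S z)%E;
       forall u : 'rV[R[i]]_n -> \bar R, LS S u ->
         forall w : 'rV[R[i]]_n, LS S (fun z => u (z - w));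
       forall u : 'rV[R[i]]_n -> \bar R, LS S u ->
         forall psi : 'rV[R[i]]_n -> R, mollifier psi ->
         forall delta : R, 0 < delta -> LS S (convol u (psi_delta psi delta))].
Proof.
move=> cS vS SR S0; tfae.
- by move=> lS; apply: phiS_hatS => //; exact: lower_set_phiS.
- by move=> /(hatS_lower cS S0) lS; apply: lower_set_phiS.
- exact: HS_translate.
(* Plurisubharmonicity is translation invariant by itself; (iv) serves for the growth bound. *)
- move=> H u [[uy uu usub] [c uc]] w; split.
    split=> [z|z d|a b]; first exact: uy.
    + move=> /uu[r r0 h]; exists r => // y yr; apply: h.
      by rewrite opprB addrA subrK.
    + have := usub (a - w) b; under eq_integral do rewrite addrAC; exact.
  exists (c + phiS S (onesv R n) * supnorm w) => z.
  apply: (le_trans (uc _)); rewrite EFinD -addeA leeD2l//.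
(* The step from (v) to (vi) passes through (iii), which gives both the local upper bounds and the
   growth estimate for the convolution. *)
- move=> H u uLS psi pm d d0.
  have Hphi := translate_phiS cS SR S0 H.
  have [K [B [K1 B0 qk]]] := kernel_psi_delta pm d0.
  by apply: (convol_LS cS SR S0 _ B0 qk) => //; exact: le_trans K1.
- move=> /(mollify_phiS cS SR S0) H; apply: hatS_lower => //.
  exact: phiS_hatS.
Qed.
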